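(* For every real $\alpha>0$ and integer $d\ge1$ such that $\alpha d\ge 150$, there exists $\beta_0=\beta_0(\alpha,d)>0$ such that the speed $v(\beta)$ of the multiplicative once-reinforced random walk with parameters $\alpha,\beta$ on the $d$-regular tree is strictly monotone decreasing in $\beta$ for $\beta\in[0,\beta_0]$.
   Context: The $d$-regular tree $\mathbb{T}_d$ is the rooted tree with root $\varrho$ in which every vertex has exactly $d$ children, augmented by an extra vertex $\varrho^{-1}$ (the parent of $\varrho$) whose only neighbour is $\varrho$; $|\varrho^{-1}|=-1$ and $|\nu|$ is the graph distance from $\nu$ to $\varrho$ for all other vertices. The multiplicative once-reinforced biased random walk $\boldsymbol{X}$ with parameters $\alpha>0$, $\beta\ge0$ starts at $X_0=\varrho^{-1}$, always steps from $\varrho^{-1}$ to $\varrho$, and from a vertex $\nu\neq\varrho^{-1}$ at time $n$, given the past, steps to a neighbour with probability proportional to weights: the edge to the parent of $\nu$ has weight $1+\beta$; the edge to a child of $\nu$ has weight $\alpha$ if it has not been crossed by time $n$, and $\alpha(1+\beta)$ if it has been crossed. The speed $v(\beta)$ is the deterministic almost sure limit of $|X_n|/n$. *)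

(* Defs.v *)
From mathcomp Require Import all_boot all_order all_algebra.
From mathcomp Require Import all_classical all_reals all_analysis.
Import Order.TTheory GRing.Theory Num.Theory.
Import numFieldNormedType.Exports.

Set Implicit Arguments.
Unset Strict Implicit.
Unset Printing Implicit Defensive.

Local Open Scope classical_set_scope.
Local Open Scope ring_scope.

(* [None] is the extra vertex rho^-1 and [Some s] is the vertex reached from
   the root [Some [::]] by the word [s], most recent letter first: the children
   of [Some s] are the [Some (i :: s)]. *)
Definition vertex (d : nat) : Type := option (seq 'I_d).

Definition rho_inv (d : nat) : vertex d := None.

Definition root (d : nat) : vertex d := Some [::].

Definition child (d : nat) (s : seq 'I_d) (i : 'I_d) : vertex d := Some (i :: s).

Definition parent (d : nat) (s : seq 'I_d) : vertex d :=
  if s is _ :: s' then Some s' else rho_inv d.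

Definition height (d : nat) (u : vertex d) : int :=
  if u is Some s then (size s)%:Z else -1.

Definition crossed (d : nat) (x : nat -> vertex d) (n : nat)
    (u w : vertex d) : bool :=
  [exists m : 'I_n, ((x m == u) && (x m.+1 == w)) ||
                    ((x m == w) && (x m.+1 == u))].

Section Walk.
Context {R : realType}.
Variables (alpha beta : R) (d : nat).

Definition child_weight (x : nat -> vertex d) (n : nat) (s : seq 'I_d)
    (i : 'I_d) : R :=
  if crossed x n (Some s) (child s i) then alpha * (1 + beta) else alpha.

Definition edge_weight (x : nat -> vertex d) (n : nat) (s : seq 'I_d)
    (w : vertex d) : R :=
  if w == parent s then 1 + beta
  else \sum_(i < d | w == child s i) child_weight x n s i.

(* Probability of stepping to [w] at time [n.+1], given the past
   x 0, ..., x n; the values of [x] after time [n] are irrelevant. *)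
Definition step_prob (x : nat -> vertex d) (n : nat) (w : vertex d) : R :=
  if x n is Some s then
    edge_weight x n s w /
      (1 + beta + \sum_(i < d) child_weight x n s i)
  else (w == root d)%:R.

Definition is_orrw (disp : measure_display) (Omega : measurableType disp)
    (P : probability Omega R) (X : nat -> Omega -> vertex d) : Prop :=
  [/\ forall (n : nat) (w : vertex d), measurable (X n @^-1` [set w]),
      P (X 0%N @^-1` [set rho_inv d]) = 1%E &
      forall (n : nat) (x : nat -> vertex d) (w : vertex d),
        let past := [set omega | forall m, (m <= n)%N -> X m omega = x m] in
        P (past `&` X n.+1 @^-1` [set w]) = (P past * (step_prob x n w)%:E)%E].

(* The law of the walk is determined by [is_orrw], so the speed does not depend
   on the realization; the first clause rules out a vacuous second one. *)
Definition is_speed (v : R) : Prop :=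
  (exists (disp : measure_display) (Omega : measurableType disp)
     (P : probability Omega R) (X : nat -> Omega -> vertex d), is_orrw P X) /\
  (forall (disp : measure_display) (Omega : measurableType disp)
     (P : probability Omega R) (X : nat -> Omega -> vertex d), is_orrw P X ->
     {ae P, forall omega,
        (fun n : nat => (height (X n omega))%:~R / n%:R : R) @ \oo --> v}).

End Walk.

(* Main.v *)
Require Import Defs.
From HB Require Import structures.
From mathcomp Require Import all_boot all_order all_algebra.
From mathcomp Require Import all_classical all_reals all_analysis.
From mathcomp Require Import ring lra zify.
Import Order.TTheory GRing.Theory Num.Theory.
Import numFieldNormedType.Exports.
Set Implicit Arguments.
Unset Strict Implicit.
Unset Printing Implicit Defensive.
Local Open Scope ring_scope.

(** The walk is a Markov chain on pairs (position, set of crossed edges).  It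
    goes down with probability at most [1/50], so its depth [back] below the
    highest level reached so far has exponential moments.  From two states at
    the highest level the walk sees the same fresh subtree, so both runs can be
    coupled until they leave it, which is unlikely; otherwise one waits for the
    next record.  Hence the expected sum of a local function over [m] steps
    depends on the initial state by at most a multiple of [1 + lag], uniformly
    in [m] and [beta] ([gain_osc]).

    For the height this makes the expectations almost additive, which yields a
    slope [v], and the second moment around [n v] linear in [n]; Chebyshev along
    the squares and the Borel-Cantelli lemma give the almost sure speed.

    Replacing [beta] by [beta'] one step at a time, the same estimate shows
    that long-run averages are Lipschitz in [beta].  The probability of a step
    down is [p0 beta - beta * chi], where [chi] vanishes on records and is at
    most [2 / (1 + alpha d)]; as records are frequent, its average [c beta] is
    small compared with the rate [1 / (2 (1 + alpha d))] at which [p0]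
    increases.  So [v = 1 - 2 p0 + 2 beta c] decreases for small [beta], the
    variation of [c] entering only with the factor [beta].

    The walk itself is built on [[0, 1)], cut recursively into intervals whose
    lengths are the probabilities of the finite trajectories. *)

(** * States and one-step expectations *)

(* An edge is named by its lower endpoint, and [back] is the depth of the
   current vertex below the highest level reached so far. *)
Record state (d : nat) := State {
  cur : vertex d;
  cross : seq 'I_d -> bool;
  back : nat }.

(** At [rho_inv] every [o] leads to the root. The truncated predecessor keeps [back] at zero when a
    step up sets a new record. *)
Definition step d (s : state d) (o : option 'I_d) : state d :=
  match cur s, o with
  | None, _ =>
      State (Some [::]) (fun e => (e == [::]) || cross s e) (back s).-1
  | Some u, None =>
      State (parent u) (fun e => (e == u) || cross s e) (back s).+1
  | Some u, Some i =>
      State (child u i) (fun e => (e == i :: u) || cross s e) (back s).-1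
  end.

Definition init d : state d := State (rho_inv d) (fun=> false) 0.

Definition hh d (u : vertex d) : nat := if u is Some u' then (size u').+1 else 0.

(* Zero exactly at a record away from [rho_inv]. *)
Definition lag d (s : state d) : nat := back s + (hh (cur s) == 0%N).

(** The record level is [hh (cur s) + back s] and no edge beyond it is crossed; at a record the
    subtree of the current vertex is therefore fresh. *)
Definition wf d (s : state d) : Prop :=
  forall e, cross s e -> (size e < hh (cur s) + back s)%N.

Lemma wf_init d : wf (init d). Proof. by []. Qed.

Lemma hh_parent d (u : seq 'I_d) : hh (parent u) = size u.
Proof. by case: u. Qed.

Lemma wf_step d (s : state d) o : wf s -> wf (step s o).
Proof.
rewrite /wf /step; case: s => -[u|] c b /= ws; last first.
  by move=> e /orP[/eqP->|/ws]/=; lia.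
case: o => [i|] e /orP[/eqP->|/ws] /=; rewrite ?hh_parent; lia.
Qed.

Lemma lag_up d (s : state d) i : (lag (step s (Some i)) <= (lag s).-1)%N.
Proof. by rewrite /lag /step; case: s => -[u|] c b /=; lia. Qed.

(** [back] grows by one, and an arrival at [rho_inv] adds another unit. *)
Lemma lag_down d (s : state d) : (lag (step s None) <= (lag s).+2)%N.
Proof. by rewrite /lag /step; case: s => -[u|] c b /=; rewrite ?hh_parent; lia. Qed.

Lemma lag_None d (s : state d) o : cur s = None ->
  (lag (step s o) <= (lag s).-1)%N.
Proof. by rewrite /lag /step; case: s => -[u|] c b //= _; lia. Qed.

Lemma hh_step d (s : state d) o :
  hh (cur (step s o)) = (if (cur s, o) is (Some _, None) then (hh (cur s)).-1
                         else (hh (cur s)).+1).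
Proof.
by case: s => -[u|] c b; case: o => [i|] //=; rewrite ?hh_parent.
Qed.

Section Operator.
Context {R : realType}.
Variables (alpha beta : R) (d : nat).
Implicit Types (s : state d) (g : state d -> R).

Definition cweight s (u : seq 'I_d) (i : 'I_d) : R :=
  if cross s (i :: u) then alpha * (1 + beta) else alpha.

Definition total s u : R := 1 + beta + \sum_(i < d) cweight s u i.

Definition prob s (o : option 'I_d) : R :=
  match cur s, o with
  | None, _ => (o == None)%:R
  | Some u, None => (1 + beta) / total s u
  | Some u, Some i => cweight s u i / total s u
  end.

Definition Ex1 g s : R := \sum_o prob s o * g (step s o).

Definition Ex n g : state d -> R := iter n Ex1 g.

(** The expected sum of [f] over the first [m] states of the chain, the initial state [s]
    included. *)
Fixpoint gain (f : state d -> R) m s : R :=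
  if m is m'.+1 then f s + Ex1 (gain f m') s else 0.

Hypothesis a0 : 0 < alpha.
Hypothesis b0 : 0 <= beta.

Lemma cweight_gt0 s u i : 0 < cweight s u i.
Proof.
by rewrite /cweight; case: ifP => _ //; apply: mulr_gt0 => //; have := b0; lra.
Qed.

Lemma total_gt0 s u : 0 < total s u.
Proof.
rewrite /total; apply: ltr_wpDr; last by have := b0; lra.
by apply: sumr_ge0 => i _; exact/ltW/cweight_gt0.
Qed.

Lemma sum_option (h : option 'I_d -> R) : \sum_o h o = h None + \sum_i h (Some i).
Proof.
rewrite (bigD1 None) //=; congr (_ + _).
rewrite (reindex_omap (Some : 'I_d -> option 'I_d) id) => [|[i|]//].
by apply: eq_bigl => i; rewrite eqxx.
Qed.

Lemma prob_ge0 s o : 0 <= prob s o.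
Proof.
rewrite /prob; case: (cur s) => [u|]; last exact: ler0n.
have t := total_gt0 s u; case: o => [i|]; apply: divr_ge0; try exact: ltW.
- exact/ltW/cweight_gt0.
- by have := b0; lra.
Qed.

Lemma sum_prob s : \sum_o prob s o = 1.
Proof.
rewrite sum_option /prob; case: (cur s) => [u|]; last by rewrite big1 ?addr0.
by rewrite -mulr_suml -mulrDl divff // lt0r_neq0 // total_gt0.
Qed.

Lemma Ex1_le g h s : (forall o, g (step s o) <= h (step s o)) ->
  Ex1 g s <= Ex1 h s.
Proof. by by move=> gh; apply: ler_sum => o _; rewrite ler_wpM2l ?prob_ge0. Qed.

Lemma Ex1_cst c s : Ex1 (fun=> c) s = c.
Proof. by rewrite /Ex1 -mulr_suml sum_prob mul1r. Qed.

Lemma Ex1D g h s : Ex1 (fun t => g t + h t) s = Ex1 g s + Ex1 h s.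
Proof. by rewrite -big_split; apply: eq_bigr => o _; rewrite mulrDr. Qed.

Lemma Ex1Z c g s : Ex1 (fun t => c * g t) s = c * Ex1 g s.
Proof. by rewrite /Ex1 mulr_sumr; apply: eq_bigr => o _; rewrite mulrCA. Qed.

Lemma Ex1B g h s : Ex1 (fun t => g t - h t) s = Ex1 g s - Ex1 h s.
Proof.
rewrite -[in RHS]mulN1r -Ex1Z -Ex1D; congr Ex1.
by apply: funext => t; rewrite mulN1r.
Qed.

Lemma Ex1_abs g s : `|Ex1 g s| <= Ex1 (fun t => `|g t|) s.
Proof.
apply: le_trans (ler_norm_sum _ _ _) _; apply: ler_sum => o _.
by rewrite normrM (ger0_norm (prob_ge0 _ _)).
Qed.

(* These two hypotheses enter only through the bound [1/50] on the probability
   of a step down. *)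
Hypothesis b1 : beta <= 1.
Hypothesis ad : 150 <= alpha * d%:R.

Lemma total_ge s u : 1 + beta + alpha * d%:R <= total s u.
Proof.
rewrite /total lerD2l -[d in _ * d%:R]card_ord -sum1_card natr_sum mulr_sumr.
apply: ler_sum => i _; rewrite mulr1 /cweight; case: ifP => _ //.
by rewrite mulrDr mulr1 lerDl mulr_ge0 // ltW.
Qed.

Lemma prob_down s u : cur s = Some u -> prob s None <= 50^-1.
Proof.
rewrite /prob => ->; have t := total_ge s u; have := (b0, b1, ad) => -[[bge0 ble1] adge].
rewrite ler_pdivrMr; [lra|exact: total_gt0].
Qed.

(** As [U <= D], the bound grows with the probability of a step down, which may thus be replaced by
    [1/50]. *)
Lemma sum_le_two s (h : option 'I_d -> R) D U : cur s != None ->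
  h None <= D -> (forall i, h (Some i) <= U) -> U <= D ->
  \sum_o prob s o * h o <= 50^-1 * D + (1 - 50^-1) * U.
Proof.
case Eu: (cur s) => [u|//] _ hD hU UD.
have pd := prob_down Eu; have p0 := prob_ge0 s None.
have ps : \sum_i prob s (Some i) = 1 - prob s None.
  by rewrite -(sum_prob s) sum_option addrAC subrr add0r.
rewrite sum_option.
have : \sum_i prob s (Some i) * h (Some i) <= (1 - prob s None) * U.
  by rewrite -ps mulr_suml; apply: ler_sum => i _; rewrite ler_wpM2l ?prob_ge0.
have := ler_wpM2l p0 hD.
have : prob s None * (D - U) <= 50^-1 * (D - U) by apply: ler_wpM2r pd; lra.
lra.
Qed.

Lemma Ex1_le_two g s D U : cur s != None -> g (step s None) <= D ->
  (forall i, g (step s (Some i)) <= U) -> U <= D ->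
  Ex1 g s <= 50^-1 * D + (1 - 50^-1) * U.
Proof. by move=> cN gD gU; apply: sum_le_two. Qed.

Lemma Ex1_None g s : cur s = None -> Ex1 g s = g (step s None).
Proof.
move=> Eu; rewrite /Ex1 sum_option /prob Eu eqxx mul1r big1 ?addr0 // => i _.
by rewrite mul0r.
Qed.

Definition Phi s : R := 2 ^+ lag s.

Lemma Phi_ge1 s : 1 <= Phi s. Proof. by apply: exprn_ege1; lra. Qed.

Lemma lag_le_Phi s : (1 + (lag s)%:R) <= Phi s.
Proof.
by rewrite nat1r /Phi -natrX ler_nat ltn_expl.
Qed.
End Operator.

(** * Dependence on the initial state *)

(** Coupled states are never at [rho_inv], so agreement is asked only away from it. *)
Definition local (T : Type) d (f : state d -> T) : Prop :=
  forall s1 s2 u1 u2, cur s1 = Some u1 -> cur s2 = Some u2 ->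
    (forall i, cross s1 (i :: u1) = cross s2 (i :: u2)) -> f s1 = f s2.

(* The walks from [s1] and [s2] have made the same excursion, ending at depth
   [size t], in two subtrees that were fresh at its start. *)
Definition coupled d (t : seq 'I_d) (s1 s2 : state d) : Prop :=
  exists v1 v2, [/\ cur s1 = Some (t ++ v1), cur s2 = Some (t ++ v2),
    back s1 = back s2 &
    forall t', t' != [::] -> cross s1 (t' ++ v1) = cross s2 (t' ++ v2)].

Lemma eqseq_cat2r (T : eqType) (u v w : seq T) : (u ++ w == v ++ w) = (u == v).
Proof.
have [uv|uv] := eqVneq (size u) (size v).
  by rewrite eqseq_cat // eqxx andbT.
transitivity false; [|symmetry]; apply/negbTE; apply: contraNneq uv.
  by move=> /(congr1 size) /eqP; rewrite !size_cat eqn_add2r.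
by move=> ->.
Qed.

Lemma coupled_up d t (s1 s2 : state d) i : coupled t s1 s2 ->
  coupled (i :: t) (step s1 (Some i)) (step s2 (Some i)).
Proof.
move=> [v1 [v2 []]]; case: s1 => /= _ c1 b1 ->; case: s2 => /= _ c2 b2 -> -> c12.
exists v1, v2; rewrite /step /=; split => // t' t0.
by rewrite c12 // -!cat_cons !eqseq_cat2r.
Qed.

(** As the excursion has positive depth, the step stays in the subtree, and the edge it crosses is
    named by a word that properly extends [v1] or [v2]. *)
Lemma coupled_down d t (s1 s2 : state d) i : coupled (i :: t) s1 s2 ->
  coupled t (step s1 None) (step s2 None).
Proof.
move=> [v1 [v2 []]]; case: s1 => /= _ c1 b1 ->; case: s2 => /= _ c2 b2 -> -> c12.
exists v1, v2; rewrite /step /=; split => // t' t0.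
by rewrite c12 // -!cat_cons !eqseq_cat2r.
Qed.

(** At lag zero both walks stand at a record, where [wf] leaves no crossed edge in the subtree. *)
Lemma coupled0 d (s1 s2 : state d) : wf s1 -> wf s2 ->
  lag s1 = 0%N -> lag s2 = 0%N -> coupled [::] s1 s2.
Proof.
rewrite /wf /lag; case: s1 s2 => -[u1|] c1 b1 [[u2|] c2 b2] /=; try by lia.
move=> w1 w2 l1 l2; exists u1, u2; split => //=; first by lia.
move=> [//|i t'] _ /=; apply/idP/idP => [/w1|/w2] /=; rewrite size_cat; lia.
Qed.

Section Oscillation.
Context {R : realType}.
Variables (alpha beta : R) (d : nat).
Hypothesis a0 : 0 < alpha.
Hypothesis b0 : 0 <= beta.
Hypothesis b1 : beta <= 1.
Hypothesis ad : 150 <= alpha * d%:R.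
Implicit Types (s : state d).
Local Notation Ex1 := (Ex1 alpha beta).
Local Notation Ex := (Ex alpha beta).
Local Notation prob := (prob alpha beta).
Local Notation gain := (gain alpha beta).
Local Notation Phi := (@Phi R d).

(** A step up halves [Phi] unless the lag is zero, and a step down multiplies it by at most [4];
    here [4/50 + 49/100 < 3/4], and the constant [2] covers lag zero. *)
Lemma Ex1_Phi s : Ex1 Phi s <= 3 / 4 * Phi s + 2.
Proof.
have P1 := Phi_ge1 (R := R) s.
have up k : (k <= (lag s).-1)%N -> (2 : R) ^+ k <= if (lag s) is 0%N then 1 else Phi s / 2.
  move=> kl; have : (2 : R) ^+ k <= 2 ^+ (lag s).-1 by rewrite ler_weXn2l //; lra.
  rewrite /Phi; case: (lag s) => [|l] //= h.
  by rewrite exprS mulrC mulKf //; lra.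
have [cN|cN] := eqVneq (cur s) None.
  rewrite Ex1_None //; apply: le_trans (up _ (lag_None _ cN)) _.
  by clear up; move: P1; case: (lag s) => [|l]; lra.
apply: le_trans (Ex1_le_two a0 b0 b1 ad (D := 4 * Phi s)
  (U := if lag s is 0%N then 1 else Phi s / 2) cN _ _ _) _.
- rewrite /Phi; have -> : (4 : R) * 2 ^+ lag s = 2 ^+ (lag s).+2 by rewrite !exprS; ring.
  by rewrite ler_weXn2l ?lag_down //; lra.
- by move=> i; apply: up; exact: lag_up.
- by clear up; move: P1; case: (lag s) => [|l]; lra.
- rewrite /Phi in P1 *; clear up; case: (lag s) P1 => [|l]; first by rewrite expr0; lra.
  by move: (2 ^+ _) => x x1; lra.
Qed.

Lemma Ex1_lag s : (0 < lag s)%N ->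
  Ex1 (fun t => (lag t)%:R) s <= (lag s)%:R - 1 / 2.
Proof.
move=> l0; have lE : ((lag s)%:R : R) = (lag s).-1%:R + 1 by rewrite natr1 prednK.
have [cN|cN] := eqVneq (cur s) None.
  rewrite Ex1_None //.
  have : ((lag (step s None))%:R : R) <= (lag s).-1%:R by rewrite ler_nat lag_None.
  lra.
apply: le_trans (Ex1_le_two a0 b0 b1 ad (D := (lag s).+2%:R)
  (U := (lag s).-1%:R) cN _ _ _) _.
- by rewrite ler_nat lag_down.
- by move=> i; rewrite ler_nat lag_up.
- by rewrite ler_nat; lia.
- by rewrite -[in leLHS](natr1 (lag s).+1) -(natr1 (lag s)); lra.
Qed.

Lemma coupled_prob t s1 s2 o : coupled t s1 s2 -> prob s1 o = prob s2 o.
Proof.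
move=> [v1 [v2 [e1 e2 _ c12]]]; rewrite /prob e1 e2.
have cE i : cweight alpha beta s1 (t ++ v1) i = cweight alpha beta s2 (t ++ v2) i.
  by rewrite /cweight -!cat_cons c12.
have -> : total alpha beta s1 (t ++ v1) = total alpha beta s2 (t ++ v2).
  by rewrite /total; congr (_ + _); apply: eq_bigr => i _.
by case: o => [i|] //; rewrite cE.
Qed.

Lemma Ex1_wf_le g h s : wf s -> (forall s', wf s' -> g s' <= h s') ->
  Ex1 g s <= Ex1 h s.
Proof. by move=> ws gh; apply: Ex1_le => // o; apply: gh; exact: wf_step. Qed.

Lemma gainS f m s : gain f m.+1 s = f s + Ex1 (gain f m) s.
Proof. by []. Qed.

Variable f : state d -> R.
Hypothesis f_local : local f.
Hypothesis f1 : forall s, `|f s| <= 1.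

Lemma gain_step m s : `|gain f m.+1 s - gain f m s| <= 1.
Proof.
elim: m s => [|m IH] s; first by rewrite /= subr0 /Ex1 big1 ?addr0 // => o _; rewrite mulr0.
rewrite !gainS opprD addrACA subrr add0r -Ex1B.
apply: le_trans (Ex1_abs a0 b0 _ _) _.
by rewrite -[leRHS](Ex1_cst a0 b0 1 s); apply: Ex1_le.
Qed.

(* For coupled runs the bound is a supermartingale in [back] and [size t] which
   dominates the second bound when the subtree is left.  In the second part the
   run from a state of positive lag makes one step alone, which lowers its
   expected lag by [1/2] and so pays for the shift of time. *)
Lemma gain_osc_both m :
  (forall t s1 s2, wf s1 -> wf s2 -> coupled t s1 s2 ->
     `|gain f m s1 - gain f m s2| <= 8 * 2 ^+ back s1 / 2 ^+ size t) /\
  (forall s1 s2, wf s1 -> wf s2 ->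
     `|gain f m s1 - gain f m s2| <= 8 + 4 * ((lag s1)%:R + (lag s2)%:R)).
Proof.
elim: m => [|m [IHc IHg]].
  split => [t s1 s2 _ _ _|s1 s2 _ _] /=; rewrite subrr normr0.
    by rewrite divr_ge0 ?mulr_ge0 ?exprn_ge0.
  by rewrite addr_ge0 ?mulr_ge0 ?addr_ge0 ?ler0n.
have coup t s1 s2 : wf s1 -> wf s2 -> coupled t s1 s2 ->
     `|gain f m.+1 s1 - gain f m.+1 s2| <= 8 * 2 ^+ back s1 / 2 ^+ size t.
  move=> w1 w2 c12.
  have fE : f s1 = f s2.
    have [v1 [v2 [e1 e2 _ c]]] := c12.
    by apply: (f_local e1 e2) => i; rewrite -!cat_cons c.
  have cN : cur s1 != None by have [v1 [v2 [-> _ _ _]]] := c12.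
  have -> : gain f m.+1 s1 - gain f m.+1 s2 = \sum_o prob s1 o *
      (gain f m (step s1 o) - gain f m (step s2 o)).
    rewrite !gainS fE opprD addrACA subrr add0r /Ex1 -sumrB; apply: eq_bigr => o _.
    by rewrite (coupled_prob o c12) mulrBr.
  apply: le_trans (ler_norm_sum _ _ _) _.
  under eq_bigr => o _ do rewrite normrM (ger0_norm (prob_ge0 a0 b0 _ _)).
  set X : R := 8 * 2 ^+ back s1 / 2 ^+ size t.
  have X0 : 0 <= X by rewrite divr_ge0 ?mulr_ge0 ?exprn_ge0.
  (* A step down doubles [2 ^ back] and halves [2 ^ size t], a factor [4]; a step up at least halves
     the bound. The mean is below [X] because [4/50 + 49/100 < 1]. *)
  apply: le_trans (sum_le_two a0 b0 b1 ad (D := 4 * X) (U := X / 2) cN _ _ _) _.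
  - case: t @X X0 c12 => [|i t] X X0 c12; last first.
      apply: le_trans (IHc _ _ _ (wf_step w1) (wf_step w2) (coupled_down c12)) _.
      have -> : back (step s1 None) = (back s1).+1.
        by have [v1 [v2 [e1 _ _ _]]] := c12; rewrite /step e1.
      by rewrite /X /= !exprS invfM; lra.
    have lE s : cur s != None -> (lag (step s None) <= back s + 2)%N.
      by rewrite /lag /step; case: s => -[u|] c b //= _; rewrite hh_parent; lia.
    have [v1 [v2 [e1 e2 bb _]]] := c12.
    (* With [t] empty the subtree is left and the general bound takes over: both lags are at most
       [back s1 + 2], and [24 + 8 * back s1 <= 32 * 2 ^ back s1]. *)
    apply: le_trans (IHg _ _ (wf_step w1) (wf_step w2)) _.
    have l1 : (lag (step s1 None))%:R <= (back s1 + 2)%:R :> R by rewrite ler_nat lE.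
    have l2 : (lag (step s2 None))%:R <= (back s1 + 2)%:R :> R by rewrite ler_nat bb lE // e2.
    have : 1 + (back s1)%:R <= 2 ^+ back s1 :> R by rewrite nat1r -natrX ler_nat ltn_expl.
    have b_ge0 := ler0n R (back s1).
    by rewrite /X /= expr0 divr1; rewrite natrD in l1 l2; lra.
  - move=> i.
    apply: le_trans (IHc _ _ _ (wf_step w1) (wf_step w2) (coupled_up i c12)) _.
    have -> : back (step s1 (Some i)) = (back s1).-1.
      by have [v1 [v2 [e1 _ _ _]]] := c12; rewrite /step e1.
    have h : 2 ^+ (back s1).-1 <= 2 ^+ back s1 :> R by rewrite ler_weXn2l ?leq_pred //; lra.
    have p : 0 < (2 ^+ size t)^-1 :> R by rewrite invr_gt0 exprn_gt0.
    by have := ler_wpM2r (ltW p) h; rewrite /X /= exprS invfM; lra.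
  - by lra.
  - by lra.
split=> // s1 s2 w1 w2.
have one a b : wf a -> wf b -> (0 < lag a)%N ->
    `|gain f m.+1 a - gain f m.+1 b| <= 8 + 4 * ((lag a)%:R + (lag b)%:R).
  move=> wa wb la.
  (* The two outer terms cost at most [1] each, which is what [4] times the drop [1/2] of the
     expected lag pays for. *)
  have -> : gain f m.+1 a - gain f m.+1 b =
      f a + (Ex1 (fun t => gain f m t - gain f m b) a) - (gain f m.+1 b - gain f m b).
    by rewrite Ex1B Ex1_cst // gainS; ring.
  have fa := f1 a; have gb := gain_step m b.
  have : `|Ex1 (fun t => gain f m t - gain f m b) a| <= 
     8 + 4 * ((lag a)%:R - 1 / 2 + (lag b)%:R).
    apply: le_trans (Ex1_abs a0 b0 _ _) _.
    apply: le_trans (Ex1_wf_le (h := fun t => 8 + 4 * (lag b)%:R + 4 * (lag t)%:R) wa _) _.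
      by move=> t wt; have := IHg t b wt wb; lra.
    by rewrite Ex1D Ex1_cst // Ex1Z; have := Ex1_lag la; lra.
  rewrite !ler_norml in fa gb *; lra.
have [l1|l1] := posnP (lag s1); last exact: one.
have [l2|l2] := posnP (lag s2); last first.
  by rewrite distrC addrC [in X in _ + _ * X]addrC addrC; exact: one.
apply: le_trans (coup _ _ _ w1 w2 (coupled0 w1 w2 l1 l2)) _.
have -> : back s1 = 0%N by move: l1; rewrite /lag; lia.
by rewrite /= !expr0 l1 l2; lra.
Qed.

Lemma gain_osc m s1 s2 : wf s1 -> wf s2 ->
  `|gain f m s1 - gain f m s2| <= 8 + 4 * ((lag s1)%:R + (lag s2)%:R).
Proof. by have [_] := gain_osc_both m; exact. Qed.

End Oscillation.

(** * Moments of the height *)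

(** The inductive step needs [(n + 2) ^ 2 <= 2 * (n + 1) ^ 2], which fails for [n < 2]; the
    induction therefore starts at [n = 2]. *)
Lemma sqr_le_exp n : (n.+1 ^ 2 <= 4 * 2 ^ n)%N.
Proof.
have base k : (k.+3 ^ 2 <= 4 * 2 ^ k.+2)%N.
  elim: k => [//|k IH]; rewrite (expnS 2 k.+2); move: IH; move: (2 ^ k.+2)%N => x; nia.
by case: n => [|[|n]].
Qed.

(** A two-sided Fekete argument: comparing [u] at a product with its value at each factor puts every
    [(u n - C) / n] below every [(u m + C) / m], and the supremum of the former is the slope. *)
Lemma almost_additive_slope (R : realType) (u : nat -> R) (C : R) :
  (forall n m, `|u (n + m)%N - u n - u m| <= C) ->
  exists v, forall n, `|u n - n%:R * v| <= C.
Proof.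
move=> uC.
have C0 : 0 <= C by apply: le_trans (uC 0%N 0%N); exact: normr_ge0.
have umul n m : `|u (n * m.+1)%N - m.+1%:R * u n| <= m%:R * C.
  elim: m => [|m IH]; first by rewrite muln1 mul1r mul0r subrr normr0.
  have := uC n (n * m.+1)%N; rewrite -mulnS => h.
  move: IH; rewrite -(natr1 m.+1) -(natr1 m) !ler_norml; rewrite ler_norml in h; lra.
pose A : set R := fun x => exists n, x = (u n.+1 - C) / n.+1%:R.
have ub m : (ubound A ((u m.+1 + C) / m.+1%:R))%classic.
  move=> _ [n ->]; rewrite ler_pdivrMr ?ltr0n // mulrAC ler_pdivlMr ?ltr0n //.
  have := umul n.+1 m; have := umul m.+1 n; rewrite mulnC !ler_norml => /andP[h1 h2] /andP[h3 h4].
  rewrite -!natr1 in h1 h2 h3 h4 *.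
  by rewrite mulrDl mulrDr; lra.
have A0 : (A !=set0)%classic by exists ((u 1%N - C) / 1); exists 0%N.
exists (sup A) => -[|n]; first by rewrite mul0r subr0; have := uC 0%N 0%N; rewrite addn0 subrr sub0r normrN.
have s1 : (u n.+1 - C) / n.+1%:R <= sup A.
  by apply: ub_le_sup; [exists ((u 1%N + C) / 1); exact: (ub 0%N)|exists n].
have s2 : sup A <= (u n.+1 + C) / n.+1%:R by apply: ge_sup => //; exact: ub.
move: s1 s2; rewrite ler_pdivrMr ?ltr0n // ler_pdivlMr ?ltr0n // ler_norml; lra.
Qed.

Section Moments.
Context {R : realType}.
Variables (alpha beta : R) (d : nat).
Hypothesis a0 : 0 < alpha.
Hypothesis b0 : 0 <= beta.
Hypothesis b1 : beta <= 1.
Hypothesis ad : 150 <= alpha * d%:R.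
Implicit Types (s : state d) (g h : state d -> R).
Local Notation Ex1 := (Ex1 alpha beta).
Local Notation Ex := (Ex alpha beta).
Local Notation prob := (prob alpha beta).
Local Notation gain := (gain alpha beta).
Local Notation Phi := (@Phi R d).

Lemma Ex_le n g h s : wf s -> (forall s', wf s' -> g s' <= h s') ->
  Ex n g s <= Ex n h s.
Proof.
move=> ws gh; elim: n s ws => [|n IH] s ws; first exact: gh.
exact: Ex1_wf_le ws IH.
Qed.

Lemma Ex_cst n c s : Ex n (fun=> c) s = c.
Proof.
elim: n s => [//|n IH] s; rewrite /Ex iterS -/(Ex n _).
by rewrite (_ : Ex n _ = fun=> c) ?Ex1_cst //; exact: funext.
Qed.

Lemma ExD n g h s : Ex n (fun t => g t + h t) s = Ex n g s + Ex n h s.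
Proof.
elim: n s => [//|n IH] s; rewrite /Ex iterS -/(Ex n _).
by rewrite (_ : Ex n _ = fun t => Ex n g t + Ex n h t) ?Ex1D //; exact: funext.
Qed.

Lemma ExZ n c g s : Ex n (fun t => c * g t) s = c * Ex n g s.
Proof.
elim: n s => [//|n IH] s; rewrite /Ex iterS -/(Ex n _).
by rewrite (_ : Ex n _ = fun t => c * Ex n g t) ?Ex1Z //; exact: funext.
Qed.

Lemma ExSr n g s : Ex n.+1 g s = Ex n (Ex1 g) s.
Proof. by rewrite /Ex iterSr. Qed.

(** [8] is the fixed point of [x -> 3/4 x + 2]. *)
Lemma Ex_Phi n s : wf s -> Ex n Phi s <= Phi s + 8.
Proof.
move=> ws; elim: n => [|n IH]; first by rewrite /=; lra.
rewrite ExSr; apply: le_trans (Ex_le (h := fun t => 3 / 4 * Phi t + 2) n ws _) _.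
  by move=> t _; exact: Ex1_Phi.
by rewrite ExD ExZ Ex_cst; have := Phi_ge1 (R := R) s; lra.
Qed.

Lemma gainD f n m s : gain f (n + m) s = gain f n s + Ex n (gain f m) s.
Proof.
elim: n s => [|n IH] s; first by rewrite add0r.
rewrite addSn !gainS /Ex iterS -/(Ex n _) -addrA -Ex1D.
by congr (_ + Ex1 _ _); exact: funext.
Qed.

(* [48 = 8 + 4 * 10], where [10] bounds the expectation of [Phi] at all times. *)
Lemma gain_slope f : local f -> (forall s, `|f s| <= 1) ->
  exists v, forall n, `|gain f n (init d) - n%:R * v| <= 48.
Proof.
move=> fl f1; apply: almost_additive_slope => n m.
have w0 := @wf_init d; set s0 := init d.
have Pb := Ex_Phi n w0.
have close t : wf t -> `|gain f m t - gain f m s0| <= 8 + 4 * Phi t.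
  move=> wt; have := gain_osc a0 b0 b1 ad fl f1 m wt w0.
  by have := lag_le_Phi (R := R) t; rewrite (_ : lag s0 = 1%N) //; lra.
have up : Ex n (gain f m) s0 <= Ex n (fun t => gain f m s0 + 8 + 4 * Phi t) s0.
  by apply: Ex_le => // t /close; rewrite ler_norml; lra.
have lo : Ex n (fun t => gain f m s0 - 8 + (- 4) * Phi t) s0 <= Ex n (gain f m) s0.
  by apply: Ex_le => // t /close; rewrite ler_norml; lra.
rewrite !ExD !ExZ !Ex_cst in up lo.
have P0 : Phi s0 = 2 by rewrite /Phi (_ : lag s0 = 1%N).
by rewrite gainD ler_norml; rewrite -/s0 P0 in Pb; lra.
Qed.

Definition drift s : R := if cur s is Some _ then 1 - 2 * prob s None else 1.

Lemma drift_local : local drift.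
Proof.
move=> s1 s2 u1 u2 e1 e2 c12; rewrite /drift /prob e1 e2 /total /cweight.
by under eq_bigr => i _ do rewrite c12.
Qed.

Lemma drift_abs s : `|drift s| <= 1.
Proof.
rewrite /drift; case Eu: (cur s) => [u|]; last by rewrite normr1.
have p0 := prob_ge0 a0 b0 s None; have p1 := prob_down a0 b0 b1 ad Eu.
by rewrite ler_norml; lra.
Qed.

(** This makes [gain drift m s] the expected increase of [hh] over [m] steps from [s]. *)
Lemma Ex1_hh s : Ex1 (fun t => (hh (cur t))%:R) s = (hh (cur s))%:R + drift s.
Proof.
rewrite /drift; case Eu: (cur s) => [u|]; last by rewrite Ex1_None // hh_step Eu add0r.
have ps := sum_prob a0 b0 s; rewrite sum_option in ps.
rewrite /Ex1 sum_option hh_step Eu /=.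
under eq_bigr => i _ do rewrite hh_step Eu.
rewrite -mulr_suml -natr1 -(natr1 (size u)); move: ps.
set x := prob s None; set y := \sum_(i < d) prob s (Some i).
move=> xy; have -> : y = 1 - x by lra.
by ring.
Qed.

(* The one-step deviations of the conditional expectation of the final height
   are at most [26 (1 + lag)], whose square is at most [52 ^+ 2 * Phi]; the
   contraction [Ex1_Phi] allows to sum these bounds. *)
Lemma second_moment m s a : wf s ->
  Ex m (fun t => ((hh (cur t))%:R - a) ^+ 2) s <=
  ((hh (cur s))%:R + gain drift m s - a) ^+ 2 + 104 ^+ 2 * (2 * m%:R + Phi s).
Proof.
elim: m s => [|m IH] s ws.
  have -> : gain drift 0 s = 0 by [].
  rewrite addr0 mulr0 add0r; apply: ler_wpDr; last exact: lexx.
  by rewrite mulr_ge0 ?exprn_ge0 //; have := Phi_ge1 (R := R) s; lra.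
rewrite /Ex iterS -/(Ex m _).
(* [y] is the expected final height as seen after the first step; its mean is the one seen from
   [s]. *)
pose y t : R := (hh (cur t))%:R + gain drift m t.
apply: le_trans (Ex1_wf_le a0 b0 (h := fun t =>
  (y t - a) ^+ 2 + 104 ^+ 2 * (2 * m%:R + Phi t)) ws IH) _.
rewrite Ex1D Ex1Z Ex1D Ex1_cst //.
have yE : (hh (cur s))%:R + gain drift m.+1 s = Ex1 y s.
  by rewrite gainS /y Ex1D Ex1_hh addrA.
rewrite yE; set b := Ex1 y s.
have var : Ex1 (fun t => (y t - a) ^+ 2) s =
    (b - a) ^+ 2 + Ex1 (fun t => (y t - b) ^+ 2) s.
  rewrite (_ : (fun t => (y t - a) ^+ 2) = fun t => (b - a) ^+ 2 + (y t - b) ^+ 2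
    + 2 * (b - a) * (y t - b)); last by apply: funext => t; ring.
  by rewrite !Ex1D Ex1Z Ex1B !Ex1_cst // -/b subrr mulr0 addr0.
have dev o : `|y (step s o) - b| <= 26 * (1 + (lag s)%:R).
  have -> : y (step s o) - b = Ex1 (fun t => y (step s o) - y t) s.
    by rewrite Ex1B Ex1_cst.
  apply: le_trans (Ex1_abs a0 b0 _ _) _.
  rewrite -[leRHS](Ex1_cst a0 b0 _ s); apply: Ex1_le => // o'.
  have osc := gain_osc a0 b0 b1 ad drift_local drift_abs m
    (wf_step (o := o) ws) (wf_step (o := o') ws).
  have lE q : (lag (step s q))%:R <= (lag s)%:R + 2 :> R.
    rewrite -natrD ler_nat; case: q => [i|]; last by rewrite addn2 lag_down.
    by have := lag_up s i; lia.
  have hE q : `|(hh (cur (step s q)))%:R - (hh (cur s))%:R| <= 1 :> R.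
    rewrite hh_step; case: (cur s) => [u|]; case: q => [i|] /=;
      by rewrite ler_norml -?natr1; lra.
  have := lE o; have := lE o'; have := hE o; have := hE o'; have := ler0n R (lag s).
  by rewrite /y; rewrite !ler_norml in osc *; lra.
have sq : Ex1 (fun t => (y t - b) ^+ 2) s <= 52 ^+ 2 * Phi s.
  rewrite -[leRHS](Ex1_cst a0 b0 _ s); apply: Ex1_le => // o.
  have h : ((lag s).+1 ^ 2)%:R <= (4 * 2 ^ lag s)%:R :> R by rewrite ler_nat sqr_le_exp.
  rewrite natrM !natrX -nat1r -/(Phi s) in h.
  rewrite -real_normK ?num_real //.
  apply: (le_trans (y := (26 * (1 + (lag s)%:R)) ^+ 2)); last by rewrite exprMn; lra.
  by rewrite ler_pXn2r ?nnegrE ?dev // mulr_ge0 // addr_ge0 ?ler0n.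
(* As [104 ^ 2 = 4 * 52 ^ 2], the new variance is a quarter of [104 ^ 2 * Phi s] and fills the gap
   left by the factor [3/4]. *)
rewrite var; have := Ex1_Phi a0 b0 b1 ad s; rewrite -(natr1 m); lra.
Qed.
End Moments.

(** * Drift of the height *)

Section Linearity.
Context {R : realType}.
Variables (alpha beta : R) (d : nat).
Hypothesis a0 : 0 < alpha.
Hypothesis b0 : 0 <= beta.
Hypothesis b1 : beta <= 1.
Hypothesis ad : 150 <= alpha * d%:R.
Implicit Types (s : state d) (f g : state d -> R).
Local Notation Ex1 := (Ex1 alpha beta).
Local Notation prob := (prob alpha beta).
Local Notation total := (total alpha beta).
Local Notation gain := (gain alpha beta).
Local Notation drift := (@drift R alpha beta d).
Local Notation A := (alpha * d%:R).

Lemma gain_add f g m s : gain (fun t => f t + g t) m s = gain f m s + gain g m s.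
Proof.
elim: m s => [|m IH] s; first by rewrite addr0.
rewrite !gainS addrACA -Ex1D; congr (_ + Ex1 _ _).
exact: funext.
Qed.

Lemma gain_scale c f m s : gain (fun t => c * f t) m s = c * gain f m s.
Proof.
elim: m s => [|m IH] s; first by rewrite mulr0.
rewrite !gainS mulrDr -Ex1Z; congr (_ + Ex1 _ _).
exact: funext.
Qed.

Lemma gain_cst c m s : gain (fun=> c) m s = m%:R * c.
Proof.
elim: m s => [|m IH] s; first by rewrite mul0r.
rewrite gainS (_ : gain _ m = fun=> m%:R * c); last exact: funext.
by rewrite Ex1_cst // -natr1; ring.
Qed.

Lemma gain_le f g m s : wf s -> (forall s', wf s' -> f s' <= g s') ->
  gain f m s <= gain g m s.
Proof.
move=> ws fg; elim: m s ws => [//|m IH] s ws.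
by rewrite !gainS lerD ?fg //; exact: Ex1_wf_le ws IH.
Qed.

Definition at_rho_inv s : R := (cur s == None)%:R.

(** The expected number of visits to [rho_inv] stays bounded in [m], because [2 / 2 ^ hh] is
    superharmonic away from [rho_inv] and drops from [2] to [1] on leaving it. *)
Lemma gain_at_rho_inv m s : 0 <= gain at_rho_inv m s <= 2 / 2 ^+ hh (cur s).
Proof.
elim: m s => [|m IH] s; first by rewrite /= lexx divr_ge0 ?exprn_ge0.
have IH2 t : gain at_rho_inv m t <= 2 / 2 ^+ hh (cur t) by have /andP[] := IH t.
rewrite gainS; apply/andP; split.
  rewrite addr_ge0 ?ler0n // -[leLHS](Ex1_cst a0 b0 0 s).
  by apply: Ex1_le => // o; have /andP[] := IH (step s o).
rewrite {1}/at_rho_inv; have [cN|cN] := eqVneq (cur s) None.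
  have := IH2 (step s None); rewrite Ex1_None // hh_step cN /= !expr1 expr0; lra.
have [u cu] : exists u, cur s = Some u by case: (cur s) cN => // u _; exists u.
have q0 : 0 < (2 ^+ size u)^-1 :> R by rewrite invr_gt0 exprn_gt0.
rewrite add0r; apply: le_trans (Ex1_le_two a0 b0 b1 ad (D := 2 / 2 ^+ size u)
  (U := (2 ^+ size u)^-1 / 2) cN _ _ _) _; last 2 first.
- by lra.
- by rewrite cu /= exprS invfM; lra.
- by have := IH2 (step s None); rewrite hh_step cu.
- by move=> i; have := IH2 (step s (Some i)); rewrite hh_step cu /= !exprS !invfM; lra.
Qed.

(** [back] is a potential: its mean falls by at least [48/50] when it is positive and rises by at
    most [1/50] when it is zero. *)
Lemma gain_back m s :
  48 / 50 * gain (fun t => (0 < back t)%:R) m s <= (back s)%:R + m%:R / 50.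
Proof.
elim: m s => [|m IH] s; first by rewrite /= mulr0 mul0r addr0 ler0n.
rewrite gainS mulrDr -Ex1Z.
have : Ex1 (fun t => 48 / 50 * gain (fun t => (0 < back t)%:R) m t) s <=
    Ex1 (fun t => (back t)%:R + m%:R / 50) s by apply: Ex1_le.
rewrite Ex1D Ex1_cst // -natr1 => h.
suff : 48 / 50 * (0 < back s)%:R + Ex1 (fun t => (back t)%:R) s <= (back s)%:R + 50^-1.
  by move: h; rewrite mulrDl div1r; lra.
have bE : ((back s)%:R : R) = (back s).-1%:R + (0 < back s)%:R.
  by case: (back s) => [|b] /=; rewrite ?addr0 // natr1.
have nb := ler0n R (0 < back s)%N.
have [cN|cN] := eqVneq (cur s) None.
  rewrite Ex1_None // /step cN bE /=; lra.
have [u cu] : exists u, cur s = Some u by case: (cur s) cN => // u _; exists u.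
have := Ex1_le_two a0 b0 b1 ad (g := fun t => (back t)%:R) (D := (back s).+1%:R)
  (U := (back s).-1%:R) cN.
rewrite /step cu /= => /(_ (lexx _) (fun=> lexx _)).
rewrite ler_nat -(natr1 (back s)) bE => /(_ (leq_trans (leq_pred _) (leqnSn _))).
by case: (0 < back s)%N => /=; rewrite ?mulr1n ?mulr0n; lra.
Qed.

Definition ncross s (u : seq 'I_d) : R := \sum_(i < d) (cross s (i :: u))%:R.

Lemma ncross_bounds s u : 0 <= alpha * ncross s u <= A.
Proof.
have n0 : 0 <= ncross s u by apply: sumr_ge0 => i _; exact: ler0n.
rewrite mulr_ge0 ?(ltW a0) //= ler_wpM2l ?(ltW a0) // -[d in d%:R]card_ord -sum1_card natr_sum.
by apply: ler_sum => i _; rewrite ler_nat leq_b1.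
Qed.

Lemma totalE s u : total s u = 1 + beta + A + beta * (alpha * ncross s u).
Proof.
rewrite /total /ncross -[RHS]addrA; congr (_ + _).
have -> : d%:R = \sum_(i < d) 1 :> R by rewrite sumr_const card_ord.
rewrite !mulr_sumr -big_split /=.
by apply: eq_bigr => i _; rewrite /cweight; case: ifP => _ /=; ring.
Qed.

(** The probability of a step down from a vertex with no crossed child edge. *)
Definition p0 : R := (1 + beta) / (1 + beta + A).

Definition chi s : R := if cur s is Some u then
  p0 * (alpha * ncross s u / total s u) else 0.

Lemma p0_bounds : 0 <= p0 <= 2 / (1 + A).
Proof.
have := (b0, b1, ad) => -[[h0 h1] h2].
rewrite /p0 divr_ge0 //=; try lra.
rewrite ler_pdivrMr; last lra.
by rewrite mulrAC ler_pdivlMr; nra.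
Qed.

Lemma ratio_bounds s u : 0 <= alpha * ncross s u / total s u <= 1.
Proof.
have := (b0, b1, ad) => -[[h0 h1] h2].
have /andP[n0 nA] := ncross_bounds s u; have t0 := total_gt0 a0 b0 s u.
apply/andP; split; first by apply: divr_ge0 => //; exact: ltW.
rewrite ler_pdivrMr // mul1r totalE.
by have := mulr_ge0 h0 n0; lra.
Qed.

(** When [back s] is zero, [wf] excludes crossed child edges, so [ncross] vanishes. *)
Lemma chi_bounds s : wf s -> 0 <= chi s <= 2 / (1 + A) * (0 < back s)%:R.
Proof.
have /andP[p0_ p1] := p0_bounds.
rewrite /chi; case Eu: (cur s) => [u|] ws; last first.
  by rewrite lexx mulr_ge0 ?ler0n // (le_trans p0_ p1).
have /andP[r0 r1] := ratio_bounds s u; rewrite mulr_ge0 //=.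
case: posnP => [bk|_]; last by rewrite mulr1 (le_trans _ p1) // ler_piMr.
rewrite /ncross big1 ?mulr0 ?mul0r ?mulr0 // => i _.
by case c: (cross _ _) => //; have := ws _ c; rewrite Eu bk /= addn0 ltnn.
Qed.

Lemma chi_local : local chi.
Proof.
move=> s1 s2 u1 u2 e1 e2 c12; rewrite /chi e1 e2 !totalE /ncross.
by under eq_bigr => i _ do rewrite c12.
Qed.

Lemma chi_abs s : `|chi s| <= 1.
Proof.
have := (b0, b1, ad) => -[[h0 h1] h2].
have /andP[p0_ p1] := p0_bounds.
rewrite /chi; case Eu: (cur s) => [u|]; last by rewrite normr0.
have /andP[r0 r1] := ratio_bounds s u; rewrite ger0_norm; last exact: mulr_ge0.
apply: mulr_ile1 => //; apply: (le_trans p1).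
by rewrite ler_pdivrMr; lra.
Qed.

(* [beta * chi] is the amount by which the crossed child edges lower the
   probability of a step down. *)
Lemma driftE s : drift s =
  (1 - 2 * p0) + (2 * beta) * chi s + (2 * p0) * at_rho_inv s.
Proof.
have := (b0, b1, ad) => -[[h0 h1] h2].
rewrite /drift /chi /at_rho_inv /p0; case Eu: (cur s) => [u|] /=; last by ring.
rewrite /prob Eu totalE; have /andP[n0 nA] := ncross_bounds s u.
have := mulr_ge0 h0 n0.
move: (alpha * ncross s u) n0 nA => x x0 xA bx.
by field; apply/andP; split; lra.
Qed.

Lemma gain_drift m s : gain drift m s =
  m%:R * (1 - 2 * p0) + 2 * beta * gain chi m s + 2 * p0 * gain at_rho_inv m s.
Proof.
rewrite (funext driftE).
rewrite (gain_add (fun t => 1 - 2 * p0 + 2 * beta * chi t)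
                  (fun t => 2 * p0 * at_rho_inv t)).
rewrite (gain_add (fun=> 1 - 2 * p0) (fun t => 2 * beta * chi t)).
by rewrite gain_cst !gain_scale.
Qed.

End Linearity.

(** * Dependence on beta *)

Section Comparison.
Context {R : realType}.
Variables (alpha : R) (d : nat).
Hypothesis a0 : 0 < alpha.
Hypothesis ad : 150 <= alpha * d%:R.
Variables (b c : R).
Hypotheses (b0 : 0 <= b) (bc : b < c) (c1 : c <= 1).
Implicit Types (s : state d).
Local Notation A := (alpha * d%:R).

Let c0 : 0 <= c. Proof. exact: le_trans b0 (ltW bc). Qed.
Let b1 : b <= 1. Proof. exact: le_trans (ltW bc) c1. Qed.

Lemma cweight_le_total (beta : R) s u i : 0 <= beta ->
  cweight alpha beta s u i <= total alpha beta s u.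
Proof.
move=> beta0; rewrite /total (bigD1 i) //= addrCA lerDl addr_ge0 ?addr_ge0 //.
by apply: sumr_ge0 => j _; apply/ltW/cweight_gt0.
Qed.

Lemma ratio_lip (n1 n2 t1 t2 B : R) : 0 < t2 -> 1 <= t1 -> 0 <= n2 <= t2 ->
  `|n1 - n2| <= B -> `|t1 - t2| <= B * t1 -> `|n1 / t1 - n2 / t2| <= 2 * B.
Proof.
move=> t2p t1p /andP[n0 nt] nB tB.
have t1_gt0 : 0 < t1 by lra.
have -> : n1 / t1 - n2 / t2 = (n1 - n2) / t1 - (n2 / t2) * ((t1 - t2) / t1).
  by field; rewrite !lt0r_neq0.
apply: le_trans (ler_normB _ _) _; rewrite !normrM !normfV.
rewrite (ger0_norm n0) (gtr0_norm t2p) (gtr0_norm t1_gt0).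
have h1 : `|n1 - n2| / t1 <= B.
  rewrite ler_pdivrMr //; have := normr_ge0 (n1 - n2); nra.
have h2 : `|t1 - t2| / t1 <= B by rewrite ler_pdivrMr.
have h3 : n2 / t2 <= 1 by rewrite ler_pdivrMr // mul1r.
have h4 : 0 <= n2 / t2 by rewrite divr_ge0 // ltW.
have h5 : 0 <= `|t1 - t2| / t1 by rewrite divr_ge0 // ltW.
have : n2 / t2 * (`|t1 - t2| / t1) <= 1 * B by apply: ler_pM.
lra.
Qed.

(** [total] is affine in [beta] with slope [1 + alpha * ncross], which is at most [total] itself. *)
Lemma total_lip s u : 
  `|total alpha c s u - total alpha b s u| <= (c - b) * total alpha c s u.
Proof.
have /andP[n0 nA] := ncross_bounds a0 s u.
have -> : total alpha c s u - total alpha b s u = (c - b) * (1 + alpha * ncross s u).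
  by rewrite !totalE; ring.
rewrite normrM gtr0_norm ?subr_gt0 // ger0_norm; last by lra.
rewrite ler_wpM2l ?subr_ge0 ?(ltW bc) // totalE.
by have := mulr_ge0 c0 n0; have := c0; lra.
Qed.

Lemma total_ge1 (beta : R) s u : 0 <= beta -> 1 <= total alpha beta s u.
Proof.
move=> beta0; have := total_ge a0 beta0 s u; have h := ad; lra.
Qed.

Lemma prob_lip s o : 
  `|prob alpha c s o - prob alpha b s o| <= 2 * (1 + alpha) * (c - b).
Proof.
have cb : 0 <= c - b by rewrite subr_ge0 ltW.
have acb : 0 <= alpha * (c - b) by rewrite mulr_ge0 // ltW.
have t u := total_lip s u.
rewrite /prob; case: (cur s) => [u|]; last first.
  by rewrite subrr normr0; lra.
have tc := total_gt0 a0 c0 s u; have tb := total_gt0 a0 b0 s u.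
have tc1 := total_ge1 s u c0.
rewrite -mulrA; case: o => [i|]; apply: ratio_lip => //.
- by rewrite cweight_le_total // ltW // cweight_gt0.
- rewrite /cweight; case: ifP => _; last by rewrite subrr normr0; lra.
  rewrite (_ : _ - _ = alpha * (c - b)); last by ring.
  by rewrite ger0_norm //; lra.
- by apply: le_trans (t u) _; nra.
- apply/andP; split; first by have h := b0; lra.
  by have := total_ge a0 b0 s u; have h := ad; lra.
- rewrite (_ : _ - _ = c - b); last by ring.
  by rewrite ger0_norm //; lra.
- by apply: le_trans (t u) _; nra.
Qed.

Lemma chi_lip s : `|chi alpha c s - chi alpha b s| <= 4 * (c - b).
Proof.
have cb : 0 <= c - b by rewrite subr_ge0 ltW.
rewrite /chi; case: (cur s) => [u|]; last by rewrite subrr normr0; lra.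
have hA := ad; have hb := b0; have hb1 := b1; have hc1 := c1.
have /andP[p0c pc] := p0_bounds c0 c1 ad.
have /andP[rc rc1] := ratio_bounds a0 c0 c1 ad s u.
have /andP[rb rb1] := ratio_bounds a0 b0 b1 ad s u.
have /andP[n0 nA] := ncross_bounds a0 s u.
have pl : `|p0 alpha c d - p0 alpha b d| <= 2 * (c - b).
  have hc := c0; apply: ratio_lip; try lra.
  - by rewrite (_ : _ - _ = c - b) ?ger0_norm; [lra|lra|ring].
  - by rewrite (_ : _ - _ = c - b) ?ger0_norm; [nra|lra|ring].
have rl : `|alpha * ncross s u / total alpha c s u -
            alpha * ncross s u / total alpha b s u| <= 2 * (c - b).
  apply: ratio_lip; rewrite ?total_gt0 ?total_ge1 ?c0 //.
  - by rewrite n0 totalE; have := mulr_ge0 b0 n0; lra.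
  - by rewrite subrr normr0.
  - exact: total_lip.
have pc1 : p0 alpha c d <= 1.
  by apply: (le_trans pc); rewrite ler_pdivrMr; lra.
set x := _ / total _ c _ _ in rc rc1 rl *; set y := _ / total _ b _ _ in rb rb1 rl *.
clearbody x y; move: p0c pc1 pl; move: (p0 _ c _) (p0 _ b _) => p q p_ p1 pl.
rewrite (_ : _ - _ = p * (x - y) + (p - q) * y); last by ring.
apply: le_trans (ler_normD _ _) _; rewrite !normrM (ger0_norm p_) (ger0_norm rb).
have : p * `|x - y| <= 1 * (2 * (c - b)) by apply: ler_pM.
have : `|p - q| * y <= 2 * (c - b) * 1 by apply: ler_pM.
lra.
Qed.

Local Notation K := (2 * (1 + alpha) * d.+1%:R).

(* One step under [c] instead of [b] changes the expected later gain by the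
   oscillation of [gain] at most. *)
Lemma gain_lip f m s : local f -> (forall s, `|f s| <= 1) -> wf s ->
  `|gain alpha c f m s - gain alpha b f m s| <=
  K * (c - b) * (192 * m%:R + 96 * @Phi R d s).
Proof.
move=> fl f1.
have cb : 0 <= c - b by rewrite subr_ge0 ltW.
have K0 : 0 <= K * (c - b).
  by apply: mulr_ge0 => //; apply: mulr_ge0; [have h := a0; lra|exact: ler0n].
elim: m s => [|m IH] s ws.
  rewrite /= subrr normr0; apply: mulr_ge0 => //.
  by have := Phi_ge1 (R := R) s; lra.
rewrite !gainS opprD addrACA subrr add0r.
set g := gain alpha b f m.
(* The first term is left to the induction; the second changes the law of one step. Both laws have
   mass one, so [g] may be centred at [step s None]. *)
have -> : Ex1 alpha c (gain alpha c f m) s - Ex1 alpha b g s =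
    Ex1 alpha c (fun t => gain alpha c f m t - g t) s +
    \sum_o (prob alpha c s o - prob alpha b s o) * (g (step s o) - g (step s None)).
  rewrite Ex1B -addrA; congr (_ + _).
  under [in RHS]eq_bigr => o _ do rewrite mulrBr.
  rewrite sumrB -[X in _ - X]mulr_suml sumrB !sum_prob ?c0 // subrr mul0r subr0.
  under [in RHS]eq_bigr => o _ do rewrite mulrBl.
  by rewrite sumrB addKr.
apply: le_trans (ler_normD _ _) _.
have h1 : `|Ex1 alpha c (fun t => gain alpha c f m t - g t) s| <=
    K * (c - b) * (192 * m%:R + 96 * (3 / 4 * @Phi R d s + 2)).
  apply: le_trans (Ex1_abs a0 c0 _ _) _.
  apply: le_trans (Ex1_wf_le a0 c0 ws IH) _.
  rewrite Ex1Z Ex1D !Ex1Z Ex1_cst ?c0 // ler_wpM2l // lerD2l ler_wpM2l //.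
  exact: (Ex1_Phi a0 c0 c1 ad).
have h2 : `|\sum_o (prob alpha c s o - prob alpha b s o) *
    (g (step s o) - g (step s None))| <= K * (c - b) * (24 * @Phi R d s).
  apply: le_trans (ler_norm_sum _ _ _) _.
  have -> : K * (c - b) * (24 * @Phi R d s) =
      \sum_(o : option 'I_d) (2 * (1 + alpha) * (c - b) * (24 * @Phi R d s)).
    rewrite sumr_const cardT -cardE card_option card_ord.
    by rewrite -[RHS]mulr_natr; ring.
  apply: ler_sum => o _; rewrite normrM ler_pM ?prob_lip //.
  apply: le_trans (gain_osc a0 b0 b1 ad fl f1 m (wf_step (o := o) ws) (wf_step (o := None) ws)) _.
  have lE q : (lag (step s q))%:R <= (lag s)%:R + 2 :> R.
    rewrite -natrD ler_nat; case: q => [i|]; last by rewrite addn2 lag_down.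
    by have := lag_up s i; lia.
  have := lE o; have := lE None; have := lag_le_Phi (R := R) s; have := ler0n R (lag s).
  lra.
(* The constants close since [96 * 3/4 + 24 = 96] and [96 * 2 = 192]. *)
apply: le_trans (lerD h1 h2) _; rewrite -mulrDr ler_wpM2l // -(natr1 m).
lra.
Qed.

End Comparison.

(** * Strict decrease of the slope in [beta] *)

Section Monotone.
Context {R : realType}.
Variables (alpha : R) (d : nat).
Hypothesis a0 : 0 < alpha.
Hypothesis ad : 150 <= alpha * d%:R.
Local Notation A := (alpha * d%:R).
Local Notation K := (2 * (1 + alpha) * d.+1%:R).

(** The difference quotient is [A / ((1 + c + A) (1 + b + A))], and [(2 + A) ^ 2 <= 2 A (1 + A)] for
    [A >= 150]. *)
Lemma p0_increment (b c : R) : 0 <= b -> b < c -> c <= 1 ->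
  (c - b) / (2 * (1 + A)) <= p0 alpha c d - p0 alpha b d.
Proof.
move=> b0 bc c1; have hA := ad.
have -> : p0 alpha c d - p0 alpha b d = (c - b) * (A / ((1 + c + A) * (1 + b + A))).
  by rewrite /p0; field; apply/andP; split; lra.
rewrite ler_wpM2l ?subr_ge0 ?(ltW bc) // ler_pdivlMr; last by apply: mulr_gt0; lra.
rewrite mulrC ler_pdivrMr; last by lra.
apply: (le_trans (y := (2 + A) * (2 + A))); first by apply: ler_pM; lra.
nra.
Qed.

Lemma slope_decreasing (b c v w : R) :
  0 <= b -> b < c -> c <= 1 -> b <= (8 * (1 + A) * (4 + 192 * K))^-1 ->
  (forall n, `|gain alpha b (@drift R alpha b d) n (init d) - n%:R * v| <= 48) ->
  (forall n, `|gain alpha c (@drift R alpha c d) n (init d) - n%:R * w| <= 48) ->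
  w < v.
Proof.
move=> b0 bc c1 bK hv hw.
have c0 : 0 <= c by lra.
have b1 : b <= 1 by lra.
have hA := ad.
have K0 : 0 <= K by apply: mulr_ge0; [have h := a0; lra|exact: ler0n].
pose D := (c - b) / (8 * (1 + A)).
have D0 : 0 < D by rewrite divr_gt0 ?subr_gt0 //; lra.
(* A large [n] then contradicts [v <= w], as [D] is positive. *)
suff main n : n%:R * (w - v) <= 200 + 400 * K - n%:R * D.
  rewrite ltNge; apply/negP => vw.
  have [n] : exists n : nat, (200 + 400 * K) / D < n%:R.
    exists (Num.bound ((200 + 400 * K) / D)); apply: archi_boundP; apply: divr_ge0; [lra|exact: ltW].
  rewrite ltr_pdivrMr //; have := main n.
  have : 0 <= n%:R * (w - v) by rewrite mulr_ge0 // subr_ge0.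
  lra.
have gc := gain_drift a0 c0 c1 ad n (init d).
have gb := gain_drift a0 b0 b1 ad n (init d).
have /andP[rc rc2] := gain_at_rho_inv a0 c0 c1 ad n (init d).
have /andP[rb rb2] := gain_at_rho_inv a0 b0 b1 ad n (init d).
rewrite /= expr0 divr1 in rc2 rb2.
have /andP[pc0 pc1] := p0_bounds c0 c1 ad.
have /andP[pb0 pb1] := p0_bounds b0 b1 ad.
have w0 : wf (init d) by exact: wf_init.
set N := n%:R; have N0 : 0 <= N by exact: ler0n.
set i := (1 + A)^-1; have i0 : 0 <= i by rewrite invr_ge0; lra.
(* [chi] is at most [2 * i] off records, and [gain_back] bounds the expected time spent there by
   [N / 48]. *)
have chi_c : gain alpha c (@chi R alpha c d) n (init d) <= N * i / 24.
  have := gain_back a0 c0 c1 ad n (init d).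
  have : gain alpha c (@chi R alpha c d) n (init d) <=
      gain alpha c (fun t => 2 / (1 + A) * (0 < back t)%:R) n (init d).
    by apply: gain_le => // t wt; have /andP[] := chi_bounds a0 c0 c1 ad wt.
  rewrite gain_scale /= -/i -/N; move: (gain _ _ (fun=> _%:R) _ _) => y.
  by move=> h1 h2; have := ler_wpM2l i0 h2; lra.
(* First [chi] is changed under the law for [c], at cost [4 (c - b)] per step, then the law
   itself. *)
have chi_cb : gain alpha c (@chi R alpha c d) n (init d) - gain alpha b (@chi R alpha b d) n (init d)
    <= (c - b) * (N * (4 + 192 * K) + 192 * K).
  have h1 : gain alpha c (@chi R alpha c d) n (init d) <=
      gain alpha c (@chi R alpha b d) n (init d) + N * (4 * (c - b)).
    rewrite -(gain_cst a0 c0 (4 * (c - b)) n (init d)) -gain_add.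
    apply: gain_le => // t _; have := chi_lip a0 ad b0 bc c1 t; rewrite ler_norml; lra.
  have := gain_lip a0 ad b0 bc c1 n (@chi_local R alpha b d) (chi_abs a0 b0 b1 ad) w0.
  rewrite (_ : Phi (init d) = 2) ?ler_norml; last by rewrite /Phi /= expr1.
  rewrite -/N; lra.
have inc : N * ((c - b) * i / 2) <= N * (p0 alpha c d - p0 alpha b d).
  by rewrite ler_wpM2l //; have := p0_increment b0 bc c1; rewrite invfM -/i; lra.
have X0 : 0 <= c - b by lra.
have bK8 : b * (4 + 192 * K) <= i / 8.
  have h : 0 < 4 + 192 * K by lra.
  rewrite -ler_pdivlMr //; apply: (le_trans bK).
  by rewrite !invfM -/i; lra.
(* In units of [(c - b) * N * i], the increase of [p0] lowers the drift by at least [1], while the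
   [chi] terms give back at most [1/12 + 1/4]; a loss of [1/8] is all that [D] asks for. *)
have e1 := ler_wpM2l X0 chi_c.
have e2 := ler_wpM2l b0 chi_cb.
have e3 := ler_wpM2l (mulr_ge0 X0 N0) bK8.
have e4 : b * ((c - b) * K) <= 1 * (1 * K).
  by apply: ler_pM => //; [exact: mulr_ge0|apply: ler_pM => //; lra].
have e5 : p0 alpha c d * gain alpha c (@at_rho_inv R d) n (init d) <= 1 * 2.
  apply: ler_pM => //; apply: (le_trans pc1); rewrite ler_pdivrMr; lra.
have e6 := mulr_ge0 pb0 rb.
have := hv n; have := hw n; rewrite gc gb !ler_norml -/N => /andP[f1 _] /andP[_ f2].
have e7 : N * D = (c - b) * N * i / 8 by rewrite /D invfM -/i; ring.
have e8 := mulr_ge0 (mulr_ge0 X0 N0) i0.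
rewrite e7; lra.
Qed.
End Monotone.

(** * The law of the walk *)

Fixpoint back_of d (x : nat -> vertex d) n : nat :=
  if n is m.+1 then
    if (hh (x m) < hh (x n))%N then (back_of x m).-1 else (back_of x m).+1
  else 0.

Definition state_of d (x : nat -> vertex d) n : state d :=
  State (x n) (fun e => crossed x n (parent e) (Some e)) (back_of x n).

Definition extend d (x : nat -> vertex d) n w : nat -> vertex d :=
  fun m => if (m <= n)%N then x m else w.

Definition neighbours d (v : vertex d) : seq (vertex d) :=
  if v is Some u then parent u :: [seq child u i | i <- enum 'I_d]
  else [:: Some [::]].

Lemma crossedS d (x : nat -> vertex d) n u w :
  crossed x n.+1 u w = crossed x n u w ||
    (((x n == u) && (x n.+1 == w)) || ((x n == w) && (x n.+1 == u))).
Proof.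
apply/existsP/orP => [[[m mn] /= h]|[/existsP[[m mn] /= h]|h]].
- have [mn'|mn'] := ltnP m n; first by left; apply/existsP; exists (Ordinal mn').
  by right; have -> : n = m by lia.
- by exists (Ordinal (ltnW mn : (m < n.+1)%N)).
- by exists ord_max.
Qed.

Lemma eq_state_of d (x y : nat -> vertex d) n :
  (forall m, (m <= n)%N -> x m = y m) -> state_of x n = state_of y n.
Proof.
elim: n => [|n IH] xy.
  rewrite /state_of xy //; congr State; apply: funext => e.
  by apply/existsP/existsP => -[[]].
have [] := IH (fun m mn => xy m (leqW mn)).
move=> en ecr eb; congr State; first exact: xy.
  apply: funext => e; rewrite !crossedS en (xy n.+1) //.
  by congr (_ || _); exact: (congr1 (fun f => f e) ecr).
by rewrite /= -/(back_of _ _) eb en (xy n.+1).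
Qed.

Lemma state_of0 d (x : nat -> vertex d) : x 0%N = None -> state_of x 0 = init d.
Proof.
move=> x0; rewrite /state_of x0; congr State; apply: funext => e.
by apply/existsP => -[[]].
Qed.

Lemma parent_neq_child d (u : seq 'I_d) i : (parent u == child u i) = false.
Proof.
apply/eqP => /(congr1 (@hh d)); rewrite hh_parent /=; lia.
Qed.

(** Links trajectories to the chain: the state read off a path evolves by [step]. *)
Lemma state_of_step d (x : nat -> vertex d) n o :
  x n.+1 = cur (step (state_of x n) o) ->
  state_of x n.+1 = step (state_of x n) o.
Proof.
rewrite /step [cur (state_of x n)]/=; case En: (x n) => [u|]; last first.
  move=> E1; rewrite /state_of /= En E1; congr State.
  apply: funext => e; rewrite crossedS En E1 orbC /=.
  by case: e => [|i e] //=; rewrite !orbF andbC.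
have hu i : (u == i :: u) = false by apply/eqP => /(congr1 size) /=; lia.
case: o => [i|] E1; rewrite /= in E1; rewrite /state_of /= En E1 /=; congr State.
- apply: funext => e; rewrite crossedS En E1 orbC; congr (_ || _).
  apply/orP/eqP => [[/andP[_ /eqP[]]//|/andP[/eqP[->] /eqP]]|->].
    by case: (e) => [|j e'] //= [/(congr1 size)] /=; lia.
  by left; rewrite /= !eqxx.
- by rewrite ltnSn.
- apply: funext => e; rewrite crossedS En E1 orbC; congr (_ || _).
  apply/orP/eqP => [[/andP[/eqP pe /eqP pu]|/andP[/eqP[->]]]//|->]; last by right; rewrite !eqxx.
  have := congr1 (@hh d) pe; have := congr1 (@hh d) pu; rewrite !hh_parent /=; lia.
- by rewrite hh_parent ltnNge leqW.
Qed.

Lemma uniq_neighbours d (v : vertex d) : uniq (neighbours v).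
Proof.
case: v => [u|] //=; apply/andP; split.
  by apply/mapP => -[i _ /eqP]; rewrite parent_neq_child.
by rewrite map_inj_uniq ?enum_uniq // => i j [].
Qed.

Section Link.
Context {R : realType}.
Variables (alpha beta : R) (d : nat).
Implicit Types (x : nat -> vertex d).

Lemma step_prob_sum x n (F : vertex d -> R) :
  \sum_(w <- neighbours (x n)) step_prob alpha beta x n w * F w =
  \sum_o prob alpha beta (state_of x n) o * F (cur (step (state_of x n) o)).
Proof.
rewrite /prob /step_prob /step /=; case: (x n) => [u|]; rewrite sum_option /=.
  rewrite big_cons big_map big_enum /=; congr (_ + _).
    by rewrite /edge_weight eqxx.
  apply: eq_bigr => i _; congr (_ / _ * _).
  rewrite /edge_weight eq_sym parent_neq_child (big_pred1 i) // => j.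
  by rewrite /= eq_sym; apply/eqP/eqP => [[]|->].
by rewrite big_seq1 eqxx big1 ?addr0 // => i _; rewrite mul0r.
Qed.

Lemma step_prob_sum1 x n : 0 < alpha -> 0 <= beta ->
  \sum_(w <- neighbours (x n)) step_prob alpha beta x n w = 1.
Proof.
move=> a0 b0; rewrite -(sum_prob a0 b0 (state_of x n)).
have := step_prob_sum x n (fun=> 1).
under eq_bigr => w _ do rewrite mulr1.
by under [in RHS]eq_bigr => o _ do rewrite mulr1.
Qed.

Lemma Ex1_state_of g x n : Ex1 alpha beta g (state_of x n) =
  \sum_(w <- neighbours (x n))
    step_prob alpha beta x n w * g (state_of (extend x n w) n.+1).
Proof.
rewrite (step_prob_sum x n (fun w => g (state_of (extend x n w) n.+1))).
apply: eq_bigr => o _; congr (_ * g _).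
have E : state_of (extend x n (cur (step (state_of x n) o))) n = state_of x n.
  by apply: eq_state_of => m mn; rewrite /extend mn.
by rewrite -[in LHS]E -state_of_step // E /extend ltnn.
Qed.

End Link.

Section Law.
Local Open Scope classical_set_scope.
Context {R : realType}.
Variables (alpha beta : R) (d : nat).
Hypothesis a0 : 0 < alpha.
Hypothesis b0 : 0 <= beta.
Context (disp : measure_display) (Omega : measurableType disp)
  (P : probability Omega R) (X : nat -> Omega -> vertex d).
Hypothesis HX : is_orrw alpha beta P X.
Implicit Types (x : nat -> vertex d) (E : set Omega).

Definition past x n : set Omega :=
  [set omega | forall m, (m <= n)%N -> X m omega = x m].

Definition pr E : R := fine (P E).

Let mX n w : measurable (X n @^-1` [set w]).
Proof. by have [h _ _] := HX; exact: h. Qed.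

Lemma pastS x n w :
  past (extend x n w) n.+1 = past x n `&` X n.+1 @^-1` [set w].
Proof.
apply/seteqP; split => omega /=.
  move=> h; split; last by have := h _ (leqnn _); rewrite /extend ltnn.
  by move=> m mn; rewrite h 1?leqW // /extend mn.
move=> [h hw] m; rewrite leq_eqVlt => /orP[/eqP->|mn].
  by rewrite hw /extend ltnn.
by rewrite h // /extend -ltnS mn.
Qed.

Lemma measurable_past x n : measurable (past x n).
Proof.
elim: n => [|n IH].
  rewrite (_ : past x 0 = X 0 @^-1` [set x 0%N]) //.
  by apply/seteqP; split => omega /= => [|h m]; [exact|rewrite leqn0 => /eqP->].
rewrite (_ : past x n.+1 = past x n `&` X n.+1 @^-1` [set x n.+1]).
  exact: measurableI.
rewrite -pastS; apply/seteqP; split => omega h m mn; rewrite h // /extend.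
  by case: ifP => // /negbT; rewrite -ltnNge => nm; congr x; lia.
by case: ifP => // /negbT; rewrite -ltnNge => nm; congr x; lia.
Qed.

Lemma measurable_vertex n (S : set (vertex d)) : measurable (X n @^-1` S).
Proof.
rewrite (_ : X n @^-1` S =
    \bigcup_w (if `[< S w >] then X n @^-1` [set w] else set0)).
  apply: countable_bigcupT_measurable => [|w]; first exact: countableP.
  by case: asboolP.
apply/seteqP; split => omega /= => [h|[w _]].
  by exists (X n omega) => //; case: asboolP.
by case: asboolP => // Sw ->.
Qed.

Lemma prE E : measurable E -> P E = (pr E)%:E.
Proof. by move=> mE; rewrite /pr fineK // fin_num_measure. Qed.

Lemma pr_ge0 E : 0 <= pr E.
Proof. exact/fine_ge0/measure_ge0. Qed.

Lemma pr_split E F : measurable E -> measurable F ->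
  pr E = pr (E `&` F) + pr (E `\` F).
Proof.
move=> mE mF; apply: EFin_inj; rewrite EFinD -!prE //; last 2 first.
- exact: measurableD.
- exact: measurableI.
by rewrite addeC; exact: measureDI.
Qed.

Lemma pr_le E F : measurable E -> measurable F -> E `<=` F -> pr E <= pr F.
Proof.
by move=> mE mF EF; rewrite -lee_fin -!prE //; apply: le_measure; rewrite ?inE.
Qed.

Lemma pr_split_seq n (L : seq (vertex d)) E : uniq L -> measurable E ->
  pr E = \sum_(w <- L) pr (E `&` X n @^-1` [set w]) +
         pr (E `\` X n @^-1` [set` L]).
Proof.
elim: L E => [|w L IH] E /=.
  move=> _ mE; rewrite big_nil add0r; congr pr.
  by apply/seteqP; split => omega //= -[].
move=> /andP[wL uL] mE.
rewrite (pr_split mE (mX n w)) (IH _ uL (measurableD mE (mX n w))) big_cons addrA.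
congr (_ + _ + _).
  apply: eq_big_seq => v vL; congr pr.
  apply/seteqP; split => omega /= => [[[h _] ->]//|[h e]]; split => //; split => //.
  by rewrite e => vw; rewrite -vw vL in wL.
congr pr; apply/seteqP; split => omega /=.
  by move=> [[h hw] hL]; split => //; rewrite inE => /orP[/eqP|].
by move=> [h]; rewrite inE => /negP; rewrite negb_or => /andP[/eqP ? /negP ?].
Qed.

Lemma pr_step x n w :
  pr (past x n `&` X n.+1 @^-1` [set w]) =
  pr (past x n) * step_prob alpha beta x n w.
Proof.
have [_ _ h] := HX; rewrite /pr (h n x w) fineM ?fin_num_measure //.
exact: measurable_past.
Qed.

(** The step probabilities over the neighbours already sum to one. *)
Lemma pr_past_stray x n :
  pr (past x n `\` X n.+1 @^-1` [set` neighbours (x n)]) = 0.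
Proof.
have := pr_split_seq n.+1 (uniq_neighbours (x n)) (measurable_past x n).
under eq_bigr => w _ do rewrite pr_step.
by rewrite -mulr_sumr step_prob_sum1 // mulr1 => h; lra.
Qed.

(** Backward induction from time [n + k], splitting on the next vertex; stray vertices carry no
    mass. *)
Lemma pr_past_Ex (B : set Omega) (g : state d -> R) k n x : measurable B ->
  (forall x, x 0%N = None -> pr (past x (n + k) `&` B) =
     pr (past x (n + k)) * g (state_of x (n + k))) ->
  x 0%N = None ->
  pr (past x n `&` B) = pr (past x n) * Ex alpha beta k g (state_of x n).
Proof.
move=> mB; elim: k n x => [|k IH] n x hB x0; first by rewrite addn0 in hB; exact: hB.
have mpB : measurable (past x n `&` B) by apply: measurableI => //; exact: measurable_past.
rewrite (pr_split_seq n.+1 (uniq_neighbours (x n)) mpB).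
have -> : pr (past x n `&` B `\` X n.+1 @^-1` [set` neighbours (x n)]) = 0.
  apply/eqP; rewrite eq_le pr_ge0 andbT -(pr_past_stray x n); apply: pr_le.
  - by apply: measurableD => //; exact: measurable_vertex.
  - by apply: measurableD; [exact: measurable_past|exact: measurable_vertex].
  - by move=> omega [[]].
rewrite addr0 /Ex iterS -/(Ex _ _ k _) Ex1_state_of mulr_sumr; apply: eq_bigr => w _.
rewrite mulrA -pr_step -pastS -IH => [||]; last by rewrite /extend.
  by congr pr; rewrite pastS setIAC.
by move=> y y0; rewrite addSnnS; exact: hB.
Qed.

Lemma pr_Ex (B : set Omega) (g : state d -> R) n : measurable B ->
  (forall x, x 0%N = None -> pr (past x n `&` B) = pr (past x n) * g (state_of x n)) ->
  pr B = Ex alpha beta n g (init d).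
Proof.
move=> mB hB; have [_ P0 _] := HX.
have := @pr_past_Ex B g n 0 (fun=> None) mB hB erefl.
rewrite state_of0 //.
have -> : past (fun=> None) 0 = X 0 @^-1` [set rho_inv d].
  by apply/seteqP; split => omega /= => [|h m]; [exact|rewrite leqn0 => /eqP->].
rewrite {2}/pr P0 mul1r => <-.
rewrite (pr_split mB (mX 0 (rho_inv d))) setIC -[RHS]addr0; congr (_ + _).
apply/eqP; rewrite eq_le pr_ge0 andbT.
have <- : pr (~` (X 0 @^-1` [set rho_inv d])) = 0.
  by rewrite /pr probability_setC // P0 subee.
by apply: pr_le => [||omega []//]; [exact: measurableD|exact: measurableC].
Qed.

Lemma pr_vertex n (S : pred (vertex d)) :
  pr (X n @^-1` [set` S]) = Ex alpha beta n (fun s => (S (cur s))%:R) (init d).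
Proof.
apply: pr_Ex; first exact: measurable_vertex.
move=> x x0 /=; case Sx : (S (x n)); rewrite ?mulr1 ?mulr0.
  congr pr; apply/seteqP; split => omega /= => [[]//|h]; split => //.
  by rewrite -topredE /= h.
rewrite (_ : _ `&` _ = set0) /pr ?measure0 //.
apply/seteqP; split => omega //= -[h]; rewrite h // => hS.
by rewrite -topredE /= Sx in hS.
Qed.

(** [is_orrw] prescribes only probabilities, whereas the interpolation between squares needs heights
    that change by at most one along the path. *)
Lemma neighbour_ae : {ae P, forall omega n, X n.+1 omega \in neighbours (X n omega)}.
Proof.
apply: ae_foralln => n.
pose B := [set omega | X n.+1 omega \notin neighbours (X n omega)].
have mB : measurable B.
  have -> : B = \bigcup_v (X n @^-1` [set v] `&`
      X n.+1 @^-1` [set w | w \notin neighbours v]).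
    apply/seteqP; split => omega; last by move=> [v _ [/= xv hv]]; rewrite /B /= xv.
    by move=> h; exists (X n omega).
  apply: countable_bigcupT_measurable => [|v]; first exact: countableP.
  by apply: measurableI; exact: measurable_vertex.
have B0 : pr B = 0.
  rewrite (@pr_Ex B (fun=> 0) n mB) ?Ex_cst // => x x0; rewrite mulr0.
  rewrite -(pr_past_stray x n); congr pr; apply/seteqP; split => omega /= [h hB];
  split => //.
    by move: hB; rewrite /B /= (h n) // => /negP.
by rewrite /B /= (h n) //; apply/negP.
have PB : P B = 0%E by rewrite prE // B0.
exists B; split => // omega /= h.
by rewrite /B /=; apply/negP.
Qed.

End Law.

(** * Almost sure speed *)

Section SquaresControl.
Local Open Scope classical_set_scope.

(** Between consecutive squares [h] moves by at most [2 (m + 1)], negligible against [(m + 1) ^ 2].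
    The shift by one turns [hh] into [height]. *)
Lemma squares_control (R : realType) (h : nat -> R) (v : R) :
  (forall n, `|h n.+1 - h n| <= 1) ->
  (forall k : nat, exists M, forall m, (M <= m)%N ->
     `|h (m.+1 ^ 2)%N - (m.+1 ^ 2)%:R * v| <= (m.+1 ^ 2)%:R / k.+1%:R) ->
  (fun n => (h n - 1) / n%:R) @ \oo --> v.
Proof.
move=> h1 hsq.
have lip n k : `|h (n + k)%N - h n| <= k%:R.
  elim: k => [|k IH]; first by rewrite addn0 subrr normr0.
  rewrite addnS (_ : _ - _ = (h (n + k).+1 - h (n + k)%N) + (h (n + k)%N - h n)); last by ring.
  by apply: le_trans (ler_normD _ _) _; rewrite -(natr1 k) addrC lerD.
apply/cvgrPdist_le => e e0.
have [k hk] : exists k : nat, 1 / k.+1%:R <= e / 2 :> R.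
  exists (Num.bound (2 / e)); rewrite ler_pdivrMr ?ltr0n // -ler_pdivrMl; last by lra.
  have : 2 / e < (Num.bound (2 / e))%:R by apply: archi_boundP; rewrite divr_ge0 // ltW.
  by rewrite -natr1 mulr1 invf_div; lra.
have [M hM] := hsq k.
(* Beyond [L], the error between squares is at most [(m + 1) ^ 2 * e / 2]. *)
have [L hL] : exists L : nat, (2 * (1 + `|v|) + 1) / (e / 2) < L%:R.
  exists (Num.bound ((2 * (1 + `|v|) + 1) / (e / 2))); apply: archi_boundP.
  by rewrite divr_ge0 ?addr_ge0 ?mulr_ge0 ?addr_ge0 ?divr_ge0 // ltW.
exists ((maxn M L).+2 ^ 2)%N => // n /= nML.
have [m mn] : exists m, (m.+1 ^ 2 <= n < m.+2 ^ 2)%N.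
  have ex : exists i, (i.+1 ^ 2 <= n)%N by exists (maxn M L).+1.
  have ub i : (i.+1 ^ 2 <= n)%N -> (i <= n)%N by nia.
  case: (ex_maxnP ex ub) => m mn mmax; exists m; rewrite mn ltnNge /=.
  by apply/negP => /mmax; rewrite ltnn.
have ML : (maxn M L < m)%N.
  by case/andP: mn => _ nm; rewrite -(ltn_add2r 2) !addn2 -ltn_sqr; exact: leq_ltn_trans nm.
have [Mm Lm] : (M <= m)%N /\ (L <= m)%N by rewrite gtn_max in ML; case/andP: ML => *; split; exact: ltnW.
have {}hM := hM m Mm.
set s := (m.+1 ^ 2)%N in mn hM *; have [q nq] : exists q, n = (s + q)%N.
  by exists (n - s)%N; rewrite subnKC //; case/andP: mn.
have qm : (q <= 2 * m.+1)%N by move: mn; rewrite nq /s => /andP[_]; nia.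
have n0 : 0 < n%:R :> R.
  by rewrite ltr0n; case/andP: mn => sn _; apply: leq_trans sn; rewrite /s expn_gt0.
rewrite -[v in v - _](mulfK (lt0r_neq0 n0)) -mulrBl normrM normfV (gtr0_norm n0) ler_pdivrMr //.
have sE : s%:R = m.+1%:R * m.+1%:R :> R by rewrite -natrM mulnn.
have qR : q%:R <= 2 * m.+1%:R :> R by rewrite -natrM ler_nat.
have LR : L%:R <= m.+1%:R :> R by rewrite ler_nat leqW.
have m1 : 1 <= m.+1%:R :> R by rewrite ler1n.
have lq := lip s q; rewrite -nq in lq.
have nR : n%:R = s%:R + q%:R :> R by rewrite nq natrD.
rewrite (_ : _ - _ = q%:R * v - (h s - s%:R * v) - (h n - h s) + 1); last by rewrite nR; ring.
have t : `|q%:R * v - (h s - s%:R * v) - (h n - h s) + 1| <=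
    q%:R * `|v| + s%:R / k.+1%:R + q%:R + 1.
  apply: le_trans (ler_normD _ _) _; rewrite normr1 lerD2r.
  apply: le_trans (ler_normB _ _) _; apply: lerD => //.
  apply: le_trans (ler_normB _ _) _; apply: lerD => //.
  by rewrite normrM ger0_norm ?ler0n.
apply: (le_trans t); rewrite nR.
have v0 := normr_ge0 v.
have t1 : q%:R * (1 + `|v|) <= 2 * m.+1%:R * (1 + `|v|) by apply: ler_wpM2r => //; lra.
have t2 : s%:R / k.+1%:R <= s%:R * (e / 2).
  by move: hk; rewrite div1r => hk; apply: ler_wpM2l => //; exact: ler0n.
have t3 : m.+1%:R * (2 * (1 + `|v|) + 1) <= m.+1%:R * (m.+1%:R * (e / 2)).
  apply: ler_wpM2l; first by lra.
  rewrite -ler_pdivrMr; last by lra.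
  by apply: (le_trans (ltW hL)).
have t4 : 0 <= q%:R * e by rewrite mulr_ge0 ?ler0n ?ltW.
move: t2; set z := s%:R / k.+1%:R; clearbody z; rewrite sE => t2; lra.
Qed.

End SquaresControl.

Section StrongLaw.
Local Open Scope classical_set_scope.
Context {R : realType}.
Variables (alpha beta : R) (d : nat).
Hypothesis a0 : 0 < alpha.
Hypothesis b0 : 0 <= beta.
Hypothesis b1 : beta <= 1.
Hypothesis ad : 150 <= alpha * d%:R.
Context (disp : measure_display) (Omega : measurableType disp)
  (P : probability Omega R) (X : nat -> Omega -> vertex d).
Hypothesis HX : is_orrw alpha beta P X.
Variable v : R.
Hypothesis hv : forall n,
  `|gain alpha beta (@drift R alpha beta d) n (init d) - n%:R * v| <= 48.

(** The constant comes from [48 ^ 2 + 2 * 104 ^ 2 <= 160 ^ 2]. *)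
Lemma hh_second_moment n :
  Ex alpha beta n (fun s => ((hh (cur s))%:R - n%:R * v) ^+ 2) (init d) <=
  160 ^+ 2 * n.+1%:R.
Proof.
apply: le_trans (second_moment a0 b0 b1 ad n _ (@wf_init d)) _.
have -> : (hh (cur (init d)))%:R = 0 :> R by [].
have -> : Phi (init d) = 2 :> R by rewrite /Phi expr1.
rewrite add0r -(natr1 n).
have : (gain alpha beta (@drift R alpha beta d) n (init d) - n%:R * v) ^+ 2 <= 48 ^+ 2.
  by rewrite -real_normK ?num_real // ler_pXn2r ?nnegrE.
have := ler0n R n; lra.
Qed.

Definition deviates n (e : R) : set Omega :=
  X n @^-1` [set` fun w : vertex d => n%:R * e <= `|(hh w)%:R - n%:R * v|].

Lemma measurable_deviates n e : measurable (deviates n e).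
Proof. exact: (measurable_vertex HX). Qed.

Lemma chebyshev_deviates n e : 0 < e -> (0 < n)%N ->
  pr P (deviates n e) <= 2 * 160 ^+ 2 / e ^+ 2 / n%:R.
Proof.
move=> e0 n0; rewrite (pr_vertex a0 b0 HX).
have nR : 1 <= n%:R :> R by rewrite ler1n.
have ne : 0 < (n%:R * e) ^+ 2 by rewrite exprn_gt0 // mulr_gt0 //; lra.
have : Ex alpha beta n (fun s =>
    (n%:R * e <= `|(hh (cur s))%:R - n%:R * v|)%R%:R) (init d) <=
    Ex alpha beta n (fun s => ((n%:R * e) ^+ 2)^-1 *
       ((hh (cur s))%:R - n%:R * v) ^+ 2) (init d).
  apply: (Ex_le a0 b0) => // s _.
  have [h|_] := boolP (n%:R * e <= `|(hh (cur s))%:R - n%:R * v|); last first.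
    by rewrite mulr_ge0 ?invr_ge0 ?sqr_ge0.
  rewrite mulrC ler_pdivlMr // mul1r -[leRHS]real_normK ?num_real //.
  by rewrite ler_pXn2r ?nnegrE ?mulr_ge0 // ltW.
move/le_trans; apply; rewrite ExZ.
rewrite mulrC ler_pdivrMr //; apply: (le_trans (hh_second_moment n)).
rewrite (_ : 2 * 160 ^+ 2 / e ^+ 2 / n%:R * (n%:R * e) ^+ 2 = 160 ^+ 2 * (2 * n%:R)); last first.
  by field; apply/andP; split; apply: lt0r_neq0; lra.
by rewrite ler_wpM2l ?exprn_ge0 // -(natr1 n); lra.
Qed.

Lemma deviates_squares_ae e : 0 < e ->
  {ae P, forall omega, exists M, forall m, (M <= m)%N ->
    ~ deviates (m.+1 ^ 2) e omega}.
Proof.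
move=> e0; pose F m := deviates (m.+1 ^ 2) e.
have mF m : measurable (F m) by exact: measurable_deviates.
set C : R := 2 * 160 ^+ 2 / e ^+ 2.
have C0 : 0 <= C by rewrite divr_ge0 ?mulr_ge0 ?exprn_ge0 // ltW.
(* Bounding [1 / (m + 1) ^ 2] by twice a telescoping difference makes the series in the
   Borel-Cantelli lemma summable by hand. *)
have FC m : (P (F m) <= (2 * C * (m.+1%:R^-1 - m.+2%:R^-1))%:E)%E.
  rewrite (prE P) // lee_fin; apply: le_trans (chebyshev_deviates e0 _) _.
    by rewrite expn_gt0.
  rewrite -/C -mulrA mulrCA ler_wpM2l // natrX -(natr1 m.+1).
  have m1 : 1 <= m.+1%:R :> R by rewrite ler1n.
  move: (m.+1%:R) m1 => y y1.
  rewrite (_ : y^-1 - _ = (y * (y + 1))^-1); last by field; apply/andP; split; lra.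
  rewrite ler_pdivlMr ?mulr_gt0 //; try lra.
  by rewrite mulrC ler_pdivrMr ?exprn_gt0 //; [nra|lra].
have Flim : P (lim_sup_set F) = 0.
  apply: lim_sup_set_cvg0 => //.
  apply: (@le_lt_trans _ _ (2 * C)%:E); last exact: ltry.
  apply: lime_le; first exact: is_cvg_nneseries.
  apply: nearW => n.
  apply: (@le_trans _ _ (\sum_(0 <= i < n) (2 * C * (i.+1%:R^-1 - i.+2%:R^-1))%:E)%E).
    by apply: lee_sum => i _; exact: FC.
  rewrite sumEFin lee_fin -mulr_sumr -[leRHS]mulr1 ler_wpM2l //; first exact: mulr_ge0.
  suff -> : \sum_(0 <= i < n) (i.+1%:R^-1 - i.+2%:R^-1) = 1 - n.+1%:R^-1 :> R.
    by rewrite gerBl invr_ge0.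
  elim: n => [|n IH]; first by rewrite big_geq // invr1 subrr.
  by rewrite big_nat_recr //= IH; ring.
exists (lim_sup_set F); split => //.
  apply: bigcap_measurable => // k _; exact: bigcup_measurable.
move=> omega /= h n _; apply: contrapT => hn; apply: h; exists n => m nm dm.
by apply: hn; exists m.
Qed.

Lemma speed_ae : {ae P, forall omega,
  (fun n : nat => (height (X n omega))%:~R / n%:R : R) @ \oo --> v}.
Proof.
have dev := ae_foralln (fun k => deviates_squares_ae (e := k.+1%:R^-1) _).
have /dev {}dev k : 0 < k.+1%:R^-1 :> R by rewrite invr_gt0 ltr0n.
have nb := neighbour_ae a0 b0 HX.
apply: filterS2 nb dev => omega nb dev.
have -> : (fun n : nat => (height (X n omega))%:~R / n%:R : R) =
    fun n => ((hh (X n omega))%:R - 1) / n%:R.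
  apply: funext => n; congr (_ / _); case: (X n omega) => [u|] /=.
    by rewrite -natr1 addrK.
  by rewrite sub0r.
apply: (@squares_control R (fun n => (hh (X n omega))%:R)) => [n|k].
  have := nb n; case: (X n omega) => [u|] /=.
    rewrite inE => /orP[/eqP->|/mapP[i _ ->]] /=.
      by rewrite hh_parent -(natr1 (size u)) opprD addNKr normrN normr1.
    by rewrite -(natr1 (size u).+1) addrAC subrr add0r normr1.
  by rewrite inE => /eqP->; rewrite /= subr0 normr1.
have [M hM] := dev k; exists M => m Mm; have /negP := hM m Mm.
by rewrite -ltNge => /ltW.
Qed.
End StrongLaw.

(** * Construction of the walk *)

Section Existence.
Local Open Scope classical_set_scope.
Context {R : realType}.
Variables (alpha beta : R) (d : nat).
Hypothesis a0 : 0 < alpha.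
Hypothesis b0 : 0 <= beta.
Implicit Types (x y : nat -> vertex d) (r : R).
Local Notation sp := (step_prob alpha beta).

Lemma eq_step_prob x y n w : (forall m, (m <= n)%N -> x m = y m) ->
  sp x n w = sp y n w.
Proof.
move=> xy; rewrite /step_prob xy //; case: (y n) => [u|//].
have cE s i : child_weight alpha beta x n s i = child_weight alpha beta y n s i.
  rewrite /child_weight (_ : crossed x n _ _ = crossed y n (Some s) (child s i)) //.
  by apply: eq_existsb => m; rewrite !xy // ltnW.
rewrite /edge_weight (eq_bigr _ (fun i _ => cE u i)).
by rewrite [in X in _ / (_ + X)](eq_bigr _ (fun i _ => cE u i)).
Qed.

Lemma step_prob_ge0 x n w : 0 <= sp x n w.
Proof.
have cw s i : 0 <= child_weight alpha beta x n s i.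
  rewrite /child_weight; case: ifP => _; last exact: ltW.
  by rewrite mulr_ge0 ?(ltW a0) // addr_ge0.
rewrite /step_prob; case: (x n) => [u|//]; apply: divr_ge0.
  rewrite /edge_weight; case: ifP => _; first by rewrite addr_ge0.
  exact: sumr_ge0.
by rewrite !addr_ge0 // sumr_ge0.
Qed.

Lemma step_prob_stray x n w : w \notin neighbours (x n) -> sp x n w = 0.
Proof.
rewrite /step_prob; case: (x n) => [u|]; rewrite /= inE.
  rewrite negb_or /edge_weight => /andP[/negbTE-> wc].
  rewrite (_ : \sum_(i < d | _) _ = 0) ?mul0r // big1 // => i /eqP wi.
  by case/mapP: wc; exists i; rewrite ?mem_enum.
by move=> /negbTE->.
Qed.

Definition cum x n j : R := \sum_(v <- take j (neighbours (x n))) sp x n v.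

(* The trajectories that start with [x 0], ..., [x n] are those of the points
   of the interval of length [len x n] with left end [lo x n]. *)
Fixpoint len x n : R :=
  if n is m.+1 then len x m * sp x m (x n) else 1.

Fixpoint lo x n : R :=
  if n is m.+1 then
    lo x m + len x m * cum x m (index (x n) (neighbours (x m))) else 0.

Lemma cum0 x n : cum x n 0 = 0.
Proof. by rewrite /cum take0 big_nil. Qed.

Lemma cum_size x n : cum x n (size (neighbours (x n))) = 1.
Proof. by rewrite /cum take_size step_prob_sum1. Qed.

Lemma cum_le x n i j : (i <= j)%N -> cum x n i <= cum x n j.
Proof.
move=> ij; rewrite /cum -(subnKC ij) takeD big_cat /= lerDl.
by apply: sumr_ge0 => v _; exact: step_prob_ge0.
Qed.

Lemma cumS x n w : w \in neighbours (x n) ->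
  cum x n (index w (neighbours (x n))) + sp x n w =
  cum x n (index w (neighbours (x n))).+1.
Proof.
move=> wL; rewrite /cum (take_nth None) ?index_mem // nth_index //.
by rewrite -cats1 big_cat big_seq1.
Qed.

Lemma cum_le1 x n j : cum x n j <= 1.
Proof.
rewrite -(cum_size x n); have [jL|jL] := leqP j (size (neighbours (x n))).
  exact: cum_le.
by rewrite /cum [take j _]take_oversize ?(ltnW jL) // take_size.
Qed.

Lemma cum_step_le1 x n w :
  cum x n (index w (neighbours (x n))) + sp x n w <= 1.
Proof.
have [wL|wL] := boolP (w \in neighbours (x n)); first by rewrite cumS // cum_le1.
by rewrite step_prob_stray // addr0 cum_le1.
Qed.

Lemma cum_ge0 x n j : 0 <= cum x n j.
Proof. by rewrite -(cum0 x n) cum_le. Qed.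

Lemma len_ge0 x n : 0 <= len x n.
Proof. by elim: n => [|n IH] //=; rewrite mulr_ge0 // step_prob_ge0. Qed.

Lemma lo_nested x n : lo x n <= lo x n.+1 /\
  lo x n.+1 + len x n.+1 <= lo x n + len x n.
Proof.
split; first by rewrite /= lerDl mulr_ge0 ?len_ge0 ?cum_ge0.
by rewrite /= -addrA -mulrDr lerD2l ler_piMr ?len_ge0 ?cum_step_le1.
Qed.

Lemma lo_bounds x n : 0 <= lo x n /\ lo x n + len x n <= 1.
Proof.
elim: n => [|n [l0 l1]]; first by rewrite /= add0r.
have [h1 h2] := lo_nested x n.
by split; [exact: le_trans h1|exact: le_trans l1].
Qed.

Lemma eq_cum x y n j : (forall m, (m <= n)%N -> x m = y m) -> cum x n j = cum y n j.
Proof.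
by move=> xy; rewrite /cum xy //; apply: eq_bigr => v _; exact: eq_step_prob.
Qed.

Lemma eq_lo_len x y n : (forall m, (m <= n)%N -> x m = y m) ->
  lo x n = lo y n /\ len x n = len y n.
Proof.
elim: n => [|n IH] xy //.
have xy' m : (m <= n)%N -> x m = y m by move=> mn; rewrite xy // leqW.
have [lE nE] := IH xy'.
by rewrite /= lE nE !xy // (eq_cum _ xy') (eq_step_prob _ xy').
Qed.

(** The neighbours cut the interval of the past into consecutive half-open pieces; [r] lies in the
    first one whose right end exceeds it. *)
Definition pick_next r x n : vertex d :=
  let L := neighbours (x n) in
  nth None L (find (fun j => r < lo x n + len x n * cum x n j.+1) (iota 0 (size L))).

Lemma eq_pick_next r x y n : (forall m, (m <= n)%N -> x m = y m) -> pick_next r x n = pick_next r y n.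
Proof.
move=> xy; rewrite /pick_next xy //; have [-> ->] := eq_lo_len xy.
by congr nth; apply: eq_find => j; rewrite (eq_cum _ xy).
Qed.

Lemma pick_nextP r x n : lo x n <= r < lo x n + len x n ->
  let w := pick_next r x n in let i := index w (neighbours (x n)) in
  w \in neighbours (x n) /\
  lo x n + len x n * cum x n i <= r < lo x n + len x n * cum x n i.+1.
Proof.
move=> /andP[lr ru]; rewrite /pick_next; set L := neighbours (x n).
set p := fun j => _; set i := find p _.
have L0 : (0 < size L)%N by rewrite /L; case: (x n).
have hasp : has p (iota 0 (size L)).
  apply/hasP; exists (size L).-1; first by rewrite mem_iota; lia.
  by rewrite /p prednK // cum_size mulr1.
have iL : (i < size L)%N by rewrite -[size L](size_iota 0) -has_find.
rewrite /= index_uniq // ?uniq_neighbours //; split; first exact: mem_nth.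
apply/andP; split; last by have := nth_find 0%N hasp; rewrite -/i nth_iota.
case E : i => [|j]; first by rewrite cum0 mulr0 addr0.
have ji : (j < i)%N by rewrite E.
by have := before_find 0%N ji; rewrite nth_iota ?(ltn_trans ji) // add0n /p leNgt => ->.
Qed.

Fixpoint run r n : nat -> vertex d :=
  if n is m.+1 then extend (run r m) m (pick_next r (run r m) m) else fun=> None.

Definition walk r n : vertex d := run r n n.

Lemma run_walk r n m : (m <= n)%N -> run r n m = walk r m.
Proof.
elim: n => [|n IH]; first by rewrite leqn0 => /eqP->.
rewrite leq_eqVlt => /orP[/eqP->//|mn].
by rewrite /= /extend -ltnS mn IH.
Qed.

Lemma walkS r n : walk r n.+1 = pick_next r (walk r) n.
Proof. by rewrite /walk /= /extend ltnn; apply: eq_pick_next => m /run_walk. Qed.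

Lemma lo_walk r n : 0 <= r < 1 ->
  lo (walk r) n <= r < lo (walk r) n + len (walk r) n.
Proof.
move=> r01; elim: n => [|n IH]; first by rewrite /= add0r.
have [wL] := pick_nextP IH; rewrite /= -walkS => /andP[h1 h2].
by rewrite h1 /= -addrA -mulrDr cumS // walkS.
Qed.

(** Pieces of distinct neighbours are disjoint, and a vertex that is not a neighbour has an empty
    piece. *)
Lemma walk_uniq r x n : x 0%N = None -> lo x n <= r < lo x n + len x n ->
  forall m, (m <= n)%N -> walk r m = x m.
Proof.
move=> x0; elim: n => [|n IH] rx m; first by rewrite leqn0 => /eqP->.
have [h1 h2] := lo_nested x n.
have rn : lo x n <= r < lo x n + len x n.
  by case/andP: rx => l u; rewrite (le_trans h1 l) (lt_le_trans u h2).
rewrite leq_eqVlt => /orP[/eqP->|mn]; last exact: IH.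
have xL : x n.+1 \in neighbours (x n).
  apply: contraLR rx => /step_prob_stray xL.
  by rewrite /= xL mulr0 addr0; case: leP => // /le_lt_trans h; rewrite ltNge => ->.
rewrite walkS (eq_pick_next r (IH rn)); have [wL /andP[p1 p2]] := pick_nextP rn.
move: rx; rewrite /= -addrA -mulrDr cumS // => /andP[q1 q2].
have ord i j : (i < j)%N -> lo x n + len x n * cum x n i.+1 <= lo x n + len x n * cum x n j.
  by move=> ij; rewrite lerD2l ler_wpM2l ?len_ge0 // cum_le.
suff : index (pick_next r x n) (neighbours (x n)) = index (x n.+1) (neighbours (x n)).
  by move=> /(congr1 (nth None (neighbours (x n)))); rewrite !nth_index.
apply/eqP; rewrite eqn_leq; apply/andP; split; rewrite leqNgt; apply/negP => /ord ij.
- by have := lt_le_trans q2 (le_trans ij p1); rewrite ltxx.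
- by have := lt_le_trans p2 (le_trans ij q1); rewrite ltxx.
Qed.

Definition unit_itv : set R := `[0, 1[%classic.

Let m_unit : measurable unit_itv. Proof. exact: measurable_itv. Qed.

Definition unif01 := mrestr (@lebesgue_measure R) m_unit.

HB.instance Definition _ :=
  Measure.copy unif01 (mrestr (@lebesgue_measure R) m_unit).

Let unif01_setT : unif01 setT = 1%E.
Proof.
by rewrite /unif01 /mrestr setTI lebesgue_measure_itv /= lte_fin ltr01 sube0.
Qed.

HB.instance Definition _ := @Measure_isProbability.Build _ _ R unif01 unif01_setT.

(** The value [None] on the null set outside [[0, 1)] makes every trajectory start at [rho_inv]. *)
Definition walk_of n r : vertex d := if r \in unit_itv then walk r n else None.

Lemma past_walk_of x n : x 0%N = None ->
  past walk_of x n `&` unit_itv = `[lo x n, (lo x n + len x n)[%classic.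
Proof.
move=> x0; have [l0 l1] := lo_bounds x n.
apply/seteqP; split => r /=; rewrite /unit_itv /= !in_itv /=.
  move=> [px r01]; have xE m : (m <= n)%N -> walk r m = x m.
    by move=> /px <-; rewrite /walk_of mem_set //= in_itv.
  by have [<- <-] := eq_lo_len xE; exact: lo_walk.
move=> rI; have r01 : 0 <= r < 1.
  by case/andP: rI => h1 h2; rewrite (le_trans l0 h1) (lt_le_trans h2 l1).
split=> // m mn; rewrite /walk_of mem_set /= ?in_itv //.
exact: (walk_uniq x0 rI).
Qed.

Lemma unif01_past x n : x 0%N = None ->
  unif01 (past walk_of x n) = (len x n)%:E.
Proof.
move=> x0; rewrite /unif01 /mrestr past_walk_of // lebesgue_measure_itv /= lte_fin.
rewrite ltrDl; case: ltP => [_|h]; first by rewrite -EFinB addrAC subrr add0r.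
by congr EFin; apply/eqP; rewrite eq_le h len_ge0.
Qed.

(** The event is a union over the countably many finite histories, each giving an interval, plus
    possibly the complement of the unit interval. *)
Lemma measurable_walk_of n w : measurable (walk_of n @^-1` [set w]).
Proof.
pose F (h : seq (vertex d)) : set R :=
  if (nth None h 0 == None) && (nth None h n == w)
  then `[lo (nth None h) n, (lo (nth None h) n + len (nth None h) n)[%classic
  else set0.
have -> : walk_of n @^-1` [set w] =
   (\bigcup_h F h) `|` (if w == None then ~` unit_itv else set0).
  apply/seteqP; split => r.
    rewrite /= {1}/walk_of; case: ifPn => [/set_mem r01|/negP rI] ww; last first.
      by right; rewrite -ww eqxx => h; apply: rI; exact: mem_set.
    left; exists (mkseq (walk r) n.+1) => //.
    have hE m : (m <= n)%N -> nth None (mkseq (walk r) n.+1) m = walk r m.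
      by move=> mn; rewrite nth_mkseq.
    rewrite /F !hE // ww !eqxx /= in_itv /=.
    have [-> ->] := eq_lo_len hE; apply: lo_walk.
    by move: r01; rewrite /unit_itv /= in_itv.
  case=> [[h _]|]; last first.
    case: eqP => // -> rI; rewrite /= /walk_of memNset //.
  rewrite /F; case: ifP => // /andP[/eqP h0 /eqP <-].
  by rewrite -past_walk_of // => -[hr _]; exact: hr.
apply: measurableU; last by case: ifP => _ //; exact: measurableC.
apply: countable_bigcupT_measurable => [|h]; first exact: countableP.
by rewrite /F; case: ifP => _ //; exact: measurable_itv.
Qed.

Lemma walk_of_is_orrw : is_orrw alpha beta unif01 walk_of.
Proof.
split; first exact: measurable_walk_of.
  rewrite (_ : _ @^-1` _ = setT) ?probability_setT //.
  by apply/seteqP; split => r //= _; rewrite /walk_of; case: ifP.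
move=> n x w; rewrite -/(past walk_of x n) /= -pastS.
have xE m : (m <= n)%N -> extend x n w m = x m by rewrite /extend => ->.
have [x0|x0] := pselect (x 0%N = None).
  rewrite !unif01_past // -EFinM /= (eq_lo_len xE).2 (eq_step_prob _ xE).
  by rewrite {1}/extend ltnn.
(* No trajectory starts away from [rho_inv], so both sides vanish. *)
have past0 y m : y 0%N = x 0%N -> past walk_of y m = set0.
  move=> yx; apply/seteqP; split => r //= /(_ 0%N (leq0n _)).
  by rewrite yx /walk_of; case: ifP => _ /esym.
by rewrite (past0 x) // [past _ _ _](past0 (extend x n w)) // measure0 mul0e.
Qed.


End Existence.

Theorem theorem1p12 (R : realType) (alpha : R) (d : nat) :
  0 < alpha -> (1 <= d)%N -> 150 <= alpha * d%:R ->
  exists2 beta0 : R, 0 < beta0 &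
  exists2 v : R -> R,
    (forall beta : R, 0 <= beta <= beta0 -> is_speed alpha beta d (v beta)) &
    (forall beta1 beta2 : R, 0 <= beta1 -> beta1 < beta2 -> beta2 <= beta0 ->
       v beta2 < v beta1).
Proof.
move=> a0 _ ad.
pose K : R := 2 * (1 + alpha) * d.+1%:R.
have K0 : 0 <= K by apply: mulr_ge0; [lra|exact: ler0n].
(* [q^-1] is the threshold of [slope_decreasing], and [1 <= q] keeps [beta] below [1]. *)
pose q : R := 8 * (1 + alpha * d%:R) * (4 + 192 * K).
have q1 : 1 <= q.
  rewrite -[1]mulr1 /q; apply: ler_pM => //; lra.
have q0 : 0 < q by lra.
have qV1 : q^-1 <= 1 by rewrite invf_le1.
pose slope beta : set R := fun w => forall n,
  `|gain alpha beta (@drift R alpha beta d) n (init d) - n%:R * w| <= 48.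
(* For [beta] in [[0, 1]] a slope exists, so the default [0] is not taken there. *)
pose v beta := xget 0 (slope beta).
have vP beta : 0 <= beta -> beta <= 1 -> slope beta (v beta).
  move=> b0 b1; have [w hw] := gain_slope a0 b0 b1 ad (@drift_local R alpha beta d)
    (drift_abs a0 b0 b1 ad).
  exact: (xgetPex 0 (ex_intro _ w hw)).
exists q^-1; first by rewrite invr_gt0.
exists v => [beta /andP[b0 bq]|b c b0 bc cq].
  have b1 : beta <= 1 by exact: le_trans bq qV1.
  split; last first.
    move=> disp Omega P X HX.
    exact: (speed_ae a0 b0 b1 ad HX (vP _ b0 b1)).
  by do 4 eexists; exact: (walk_of_is_orrw d a0 b0).
have c1 : c <= 1 by exact: le_trans cq qV1.
have bq : b <= q^-1 by exact: ltW (lt_le_trans bc cq).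
apply: (slope_decreasing a0 ad b0 bc c1 bq); apply: vP; lra.
Qed.
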